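(* Let $C$ be the middle third Cantor set and let $\mu$ be the $\frac{\log 2}{\log 3}$-dimensional Hausdorff measure restricted to $C$. Then for $\mu$-almost every $x\in C$ we have $$\#\left\{1\leq n\leq N:\left|x-\frac{p}{2^n}\right|\leq \frac{1}{n^{0.01}\cdot 2^{n}}\text{ for some }p\in\mathbb{N}\right\}\sim 2\sum_{n=1}^{N}n^{-0.01}\quad\text{as } N\to\infty.$$
   Context: $F(N)\sim G(N)$ means $F(N)/G(N)\to 1$ as $N\to\infty$. The measure $\mu$ is a probability measure and coincides with the self-similar measure on $C$ giving weights $(1/2,1/2)$ to the maps $x\mapsto x/3$ and $x\mapsto (x+2)/3$. *)

(* Defs.v *)
From HB Require Import structures.
From mathcomp Require Import all_boot all_order all_algebra.
From mathcomp Require Import all_classical all_reals all_analysis.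

Set Implicit Arguments.
Unset Strict Implicit.
Unset Printing Implicit Defensive.

Import Order.TTheory GRing.Theory Num.Theory.
Import numFieldNormedType.Exports.

Local Open Scope classical_set_scope.
Local Open Scope ring_scope.

Section hausdorff_measure.
Context {R : realType}.
Implicit Types (s delta : R) (A U : set R).
Local Open Scope ereal_scope.

(* Equal to -oo on the empty set. *)
Definition diam U : \bar R :=
  ereal_sup [set `|x - y|%:E | x in U & y in U].

(* The empty set is given weight 0 for every s, including s = 0. *)
Definition hausdorff_weight s U : \bar R :=
  if U == set0 then 0 else poweR (diam U) s.

Definition hausdorff_cover delta A : set ((set R)^nat) :=
  [set U | (forall i, diam (U i) <= delta%:E) /\ A `<=` \bigcup_i U i].

Definition hausdorff_content s delta A : \bar R :=
  ereal_inf [set \sum_(i <oo) hausdorff_weight s (U i)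
            | U in hausdorff_cover delta A].

(* No normalising constant: the set [0, 1] has 1-dimensional measure 1. *)
Definition hausdorff_measure s A : \bar R :=
  ereal_sup [set hausdorff_content s delta A | delta in [set d : R | (0 < d)%R]].

Lemma hausdorff_weight0 s : hausdorff_weight s set0 = 0.
Proof. by rewrite /hausdorff_weight eqxx. Qed.

Lemma hausdorff_weight_ge0 s U : 0 <= hausdorff_weight s U.
Proof. by rewrite /hausdorff_weight; case: ifP => // _; exact: poweR_ge0. Qed.

Lemma diam0 : diam set0 = -oo.
Proof.
rewrite /diam (_ : [set _ | _ in _ & _ in _] = set0) ?ereal_sup0//.
by apply/seteqP; split => // z [x []].
Qed.

Lemma hausdorff_content_ge0 s delta A : 0 <= hausdorff_content s delta A.
Proof.
apply: le_ereal_inf_tmp => _ [U _ <-].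
by apply: nneseries_ge0 => *; exact: hausdorff_weight_ge0.
Qed.

Lemma hausdorff_content0 s delta : hausdorff_content s delta set0 = 0.
Proof.
apply/eqP; rewrite eq_le hausdorff_content_ge0 andbT.
apply: ereal_inf_lbound; exists (fun=> set0).
  by split => [i|//]; rewrite diam0 leNye.
by apply: eseries0 => i _ _; rewrite hausdorff_weight0.
Qed.

Lemma le_hausdorff_content s delta :
  {homo hausdorff_content s delta : A B / A `<=` B >-> A <= B}.
Proof.
move=> A B AB; apply/ereal_inf_le_tmp => _ [U [dU BU] <-].
by exists U => //; split => //; exact: subset_trans AB BU.
Qed.

Lemma hausdorff_content_sigma_subadditive s delta :
  sigma_subadditive (hausdorff_content s delta).
Proof.
set mu := hausdorff_content s delta.
have mu_ge0 A : 0 <= mu A by exact: hausdorff_content_ge0.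
move=> A; have [[i ioo]|] := pselect (exists i, mu (A i) = +oo).
  rewrite (eseries_pinfty _ _ ioo) ?leey// => n _.
  by rewrite -ltNye (lt_le_trans _ (mu_ge0 _)).
rewrite -forallNE => Aoo.
apply/lee_addgt0Pr => _/posnumP[e].
rewrite (le_trans _ (epsilon_trick _ _ _))//.
pose P n (B : (set R)^nat) := hausdorff_cover delta (A n) B /\
  \sum_(k <oo) hausdorff_weight s (B k) <= mu (A n) + (e%:num / (2 ^ n.+1)%:R)%:E.
have [G PG] : {G : ((set R)^nat)^nat & forall n, P n (G n)}.
  apply: (@choice _ _ P) => n.
  have en1 : (0 < e%:num / (2 ^ n.+1)%:R)%R by [].
  have fA : mu (A n) \is a fin_num.
    by rewrite ge0_fin_numE// ltey; apply/eqP; exact: Aoo.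
  have [_ [B cB <-] /ltW ltB] := lb_ereal_inf_adherent en1 fA.
  by exists B.
pose w := hausdorff_weight s \o uncurry G.
have w_ge0 x : 0 <= w x by exact: hausdorff_weight_ge0.
apply: (@le_trans _ _ (\esum_(i in setT) w i)).
  apply: ereal_inf_lbound => /=.
  have /card_esym/ppcard_eqP[f] := card_nat2.
  exists (uncurry G \o f).
    split => [i|t [i _ /(PG i).1.2 [j _ Gt]]] /=.
      by case: (f i) => a b; exact: (PG a).1.1.
    by exists (f^-1%FUN (i, j)) => //=; rewrite invK ?inE.
  rewrite -(esum_pred_image w _ xpredT) ?[fun=> _]set_true//.
  by rewrite image_eq.
rewrite (_ : esum _ _ = \sum_(i <oo) \sum_(j <oo) hausdorff_weight s (G i j)).
  apply: lee_nneseries => [i _|i _]; last exact: (PG i).2.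
  by move=> *; apply: nneseries_ge0 => *; exact: hausdorff_weight_ge0.
pose J : nat -> set (nat * nat) := fun i => [set (i, j) | j in setT].
rewrite (_ : setT = \bigcup_k J k); last first.
  by rewrite predeqE => -[a b]; split => // _; exists a => //; exists b.
rewrite esum_bigcupT//=; last first.
  apply/trivIsetP => i j _ _ ij.
  rewrite predeqE => -[n m] /=; split => //= -[] [_] _ [<-{n} _].
  by move=> [m' _] [] /esym/eqP; rewrite (negbTE ij).
rewrite -(image_id [set: nat]) -fun_true esum_pred_image//; last first.
  by move=> n _; exact: esum_ge0.
apply: eq_eseriesr => /= j _.
rewrite -(esum_pred_image w (pair j) predT)//=; last first.
  by move=> ? ? _ _; exact: (@can_inj _ _ _ snd).
by congr esum; rewrite predeqE => -[a b]; split; move=> [i _ <-]; exists i.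
Qed.

Lemma hausdorff_measure0 s : hausdorff_measure s set0 = 0.
Proof.
rewrite /hausdorff_measure (_ : image _ _ = [set 0]) ?ereal_sup1//.
apply/seteqP; split => [_ [d _ <-]|_ ->] /=; first exact: hausdorff_content0.
by exists 1%R => //=; exact: hausdorff_content0.
Qed.

Lemma hausdorff_measure_ge0 s A : 0 <= hausdorff_measure s A.
Proof.
apply: (le_trans (hausdorff_content_ge0 s 1 A)).
by apply: ereal_sup_ubound; exists 1%R => //=.
Qed.

Lemma le_hausdorff_measure s :
  {homo hausdorff_measure s : A B / A `<=` B >-> A <= B}.
Proof.
move=> A B AB; apply: ge_ereal_sup => _ [d d0 <-].
apply: (le_trans (le_hausdorff_content s d AB)).
by apply: ereal_sup_ubound; exists d.
Qed.

Lemma hausdorff_measure_sigma_subadditive s :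
  sigma_subadditive (hausdorff_measure s).
Proof.
move=> A; apply: ge_ereal_sup => _ [d d0 <-].
apply: (le_trans (hausdorff_content_sigma_subadditive s d A)).
apply: lee_nneseries => [i _ *|i _]; first exact: hausdorff_content_ge0.
by apply: ereal_sup_ubound; exists d.
Qed.

HB.instance Definition _ s := isOuterMeasure.Build R R (hausdorff_measure s)
  (hausdorff_measure0 s) (hausdorff_measure_ge0 s)
  (@le_hausdorff_measure s) (@hausdorff_measure_sigma_subadditive s).

End hausdorff_measure.

Section outer_restriction.
Context {R : realType} {T : Type}.
Variables (mu : {outer_measure set T -> \bar R}) (D : set T).
Local Open Scope ereal_scope.

Definition outer_restr (A : set T) : \bar R := mu (A `&` D).

Let outer_restr0 : outer_restr set0 = 0.
Proof. by rewrite /outer_restr set0I outer_measure0. Qed.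

Let outer_restr_ge0 A : 0 <= outer_restr A.
Proof. exact: outer_measure_ge0. Qed.

Let le_outer_restr : {homo outer_restr : A B / A `<=` B >-> A <= B}.
Proof. by move=> A B AB; apply: le_outer_measure; exact: setSI. Qed.

Let outer_restr_sigma_subadditive : sigma_subadditive outer_restr.
Proof.
by move=> F; rewrite /outer_restr setI_bigcupl; exact: outer_measure_sigma_subadditive.
Qed.

HB.instance Definition _ := isOuterMeasure.Build R T outer_restr
  outer_restr0 outer_restr_ge0 le_outer_restr outer_restr_sigma_subadditive.

End outer_restriction.

Section cantor.
Context (R : realType).

Fixpoint cantor_step (n : nat) : set R :=
  if n is m.+1 then
    [set x / 3 | x in cantor_step m] `|` [set (x + 2) / 3 | x in cantor_step m]
  else `[0, 1].

Definition cantor_set : set R := \bigcap_n cantor_step n.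

Definition cantor_outer_measure : {outer_measure set R -> \bar R} :=
  outer_restr (hausdorff_measure (ln 2 / ln 3)) cantor_set.

(* Carried by the sigma-algebra of Caratheodory measurable sets. Hausdorff
   measures are Borel regular, so a set is negligible here iff it lies in a
   Borel set of measure zero. *)
Definition cantor_measure :
    {measure set (caratheodory_type cantor_outer_measure) -> \bar R} :=
  cantor_outer_measure.

End cantor.

Definition asymp_equiv {R : realType} (F G : nat -> R) : Prop :=
  (fun N => F N / G N) @ \oo --> (1 : R).

(* Main.v *)
Require Import Defs.
From HB Require Import structures.
From mathcomp Require Import all_boot all_order all_algebra.
From mathcomp Require Import all_classical all_reals all_analysis.
From mathcomp Require Import ring lra zify.

Set Implicit Arguments.
Unset Strict Implicit.
Unset Printing Implicit Defensive.

Import Order.TTheory GRing.Theory Num.Theory.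
Import numFieldNormedType.Exports.

Local Open Scope classical_set_scope.
Local Open Scope ring_scope.

(* Write c_n(x) for the indicator of dist(2^n x, Z) <= n^(-1/100). The point is that
   |sum_(n < N) (c_n(x) - 2 n^(-1/100))| = O(N^(7/8)) for almost every x in the
   Cantor set. Choose q with 3^(q-1) < N <= 3^q and fix all ternary digits of x but
   the first q; these range over 2^q of the 3^q residues J modulo 3^q, so the second
   moment of the sum is at most (3/2)^q times its average over all residues J. For
   uniform J, expand each c_n, the indicator of an arc of Z/3^q, into characters:
   the second moment counts the coincidences 2^n xi = +-2^n' xi' modulo 3^q weighted
   by the decay 1/|xi| of the Fourier coefficients, and since 2 has order
   2 * 3^(k-1) modulo 3^k it is O(N q^2). Hence the second moment over the Cantor set
   is O(N^(3/2)), and Chebyshev at N = i^8 leaves a proportion O(1/i^2) of bad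
   ternary cylinders. A cylinder of level L has diameter 3^(-L), thus weight 2^(-L),
   so covering by bad cylinders bounds the Hausdorff measure of the limsup of the bad
   sets by 0; interpolating trivially between i^8 and (i+1)^8 costs O(i^7). *)

(** * Powers of 2 modulo powers of 3 *)

(** Lifting the exponent at 3. Among the powers [2 ^ r] with [r < 6] only [r = 0] gives 1 modulo 9,
    so 6 divides [d]. Writing [d = 3 e] with [e] even and [2 ^ e = 3 c + 1], the identity [(3 c + 1)
    ^ 3 - 1 = 9 c (3 c (c + 1) + 1)] shows that passing from [d] to [e] loses exactly one factor
    3. *)
Lemma pow3_dvd_exponent k d : (3 ^ k.+1 %| 2 ^ d - 1 -> 3 ^ k %| d)%N.
Proof.
elim: k d => [|k IH] d; first by rewrite dvd1n.
move=> h.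
have h9 : (9 %| 2 ^ d - 1)%N.
  by apply: dvdn_trans h; rewrite -[9%N]/(3 ^ 2)%N dvdn_exp2l.
have pow_gt0 e : (0 < 2 ^ e)%N by rewrite expn_gt0.
have d6 : (6 %| d)%N.
  move: h9; rewrite -eqn_mod_dvd// {1}(divn_eq d 6) expnD.
  have e : (2 ^ (d %/ 6 * 6) = 1 %[mod 9])%N.
    by rewrite mulnC expnM -modnXm exp1n.
  rewrite -modnMml e modnMml mul1n /dvdn.
  have : (d %% 6 < 6)%N by rewrite ltn_mod.
  by case: (d %% 6)%N => [|[|[|[|[|[|]]]]]].
have /dvdnP[e de] : (3 %| d)%N by apply: dvdn_trans d6.
rewrite de expnSr dvdn_pmul2r// IH//.
have : (3 %| 2 ^ e - 1)%N.
  have /dvdnP[f ->] : (2 %| e)%N.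
    by rewrite -(@Gauss_dvdl 2 e 3)// -de (dvdn_trans _ d6).
  by rewrite mulnC expnM subn1 predn_exp dvdn_mulr.
move/dvdnP => [c cE].
have {cE} cE : (2 ^ e = 3 * c + 1)%N by have := pow_gt0 e; lia.
move: h; rewrite de expnM cE expnS.
have -> : ((3 * c + 1) ^ 3 - 1 = 3 * ((3 * c) * (3 * (c * (c + 1)) + 1)))%N.
  rewrite !expnS expn0; nia.
rewrite dvdn_pmul2l// Gauss_dvdl; first by rewrite addnK.
by rewrite coprimeXl// /coprime [(3 * _)%N]mulnC gcdnMDl.
Qed.

Lemma card_modn_class N D r : (0 < D)%N ->
  (#|[pred n : 'I_N | n == r %[mod D]]| <= (N %/ D).+1)%N.
Proof.
move=> D0; pose f (n : 'I_N) : 'I_(N %/ D).+1 := inord (n %/ D).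
have fE n : f n = (n %/ D)%N :> nat.
  by rewrite inordK// ltnS leq_div2r// ltnW.
rewrite -[leqRHS]card_ord -(card_in_imset (f := f)); first exact: max_card.
move=> m n /eqP em /eqP en /(congr1 val) /=; rewrite !fE => e.
by apply: val_inj => /=; rewrite (divn_eq m D) (divn_eq n D) e em en.
Qed.

(** Put [a = logn 3 x]. Two solutions [m <= n] give that [3 ^ (q - a)] divides [2 ^ (n - m) - 1],
    hence [n = m] modulo [D = 3 ^ (q - a - 1)]. One class modulo [D] has at most
    [N / D + 1 <= 3 ^ (a + 1) + 1] members below [N]. *)
Lemma card_dilation_solutions q N x b : (0 < x < 3 ^ q)%N -> (N <= 3 ^ q)%N ->
  (#|[pred n : 'I_N | 2 ^ n * x == b %[mod 3 ^ q]]| <= 4 * 3 ^ logn 3 x)%N.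
Proof.
move=> /andP[x0 xq] Nq.
have [n0 Pn0|no] := pickP [pred n : 'I_N | 2 ^ n * x == b %[mod 3 ^ q]]; last first.
  by rewrite eq_card0.
set a := logn 3 x.
have [y cy xE] := pfactor_coprime (isT : prime 3) x0; rewrite -/a in xE.
have aq : (a < q)%N.
  rewrite -(ltn_exp2l _ _ (isT : 1 < 3)%N); apply: leq_ltn_trans xq.
  by rewrite dvdn_leq// pfactor_dvdnn.
pose D := (3 ^ (q - a).-1)%N.
have D0 : (0 < D)%N by rewrite expn_gt0.
have key (m n : nat) : (m <= n)%N -> 2 ^ m * x = b %[mod 3 ^ q] ->
    2 ^ n * x = b %[mod 3 ^ q] -> (n = m %[mod D])%N.
  move=> mn em en; apply/eqP; rewrite eqn_mod_dvd// /D.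
  apply: pow3_dvd_exponent; rewrite prednK ?subn_gt0//.
  have : (3 ^ q %| 2 ^ n * x - 2 ^ m * x)%N.
    rewrite -eqn_mod_dvd; first by rewrite en em.
    by rewrite leq_mul2r leq_exp2l// mn orbT.
  rewrite -mulnBl -[in X in (X - _)%N](subnKC mn) expnD -{2}[(2 ^ m)%N]muln1 -mulnBr.
  rewrite -mulnA Gauss_dvdr; last by rewrite coprimeXl// coprimeXr.
  rewrite {1}xE mulnA mulnC -{1}(subnKC (ltnW aq)) expnD dvdn_pmul2l ?expn_gt0//.
  by rewrite Gauss_dvdl// coprimeXl.
apply: (@leq_trans #|[pred n : 'I_N | n == n0 %[mod D]]|).
  apply/subset_leq_card/fintype.subsetP => n; rewrite !inE => /eqP hn.
  have hn0 := eqP Pn0.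
  have [mn|/ltnW nm] := leqP n0 n; first by rewrite (key n0 n).
  by rewrite eq_sym (key n n0).
apply: (leq_trans (card_modn_class N n0 D0)).
have -> : (4 * 3 ^ a = 3 ^ a.+1 + 3 ^ a)%N by rewrite expnS; lia.
rewrite -addn1 leq_add ?expn_gt0//.
rewrite -(@leq_pmul2r D)//; apply: leq_trans (leq_divM _ _) _.
apply: (leq_trans Nq); rewrite /D -expnD leq_exp2l//; lia.
Qed.

(** * Trigonometric sums *)

Lemma cosD2piz {R : realType} (x : R) (z : int) : cos (x + 2 * pi * z%:~R) = cos x.
Proof.
have nE (y : R) (n : nat) : cos (y + 2 * pi * n%:R) = cos y.
  by rewrite -(periodicn (@cosD2pi R) n y) -[pi *+ 2 *+ n]mulr_natr mulr_natl.
case: z => n; first exact: nE.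
by rewrite NegzE mulrNz mulrN -(nE (x - _) n.+1) subrK.
Qed.

(** Multiplying by [2 sin h] with [h = pi r / M] makes the sum telescope, and its two ends differ by
    [r] full turns. The condition [0 < r < M] keeps [sin h] nonzero. *)
Lemma sum_cos_nat {R : realType} (M r : nat) (a : R) : (0 < r < M)%N ->
  \sum_(J < M) cos (2 * pi * r%:R * J%:R / M%:R + a) = 0.
Proof.
move=> /andP[r0 rM].
have M0 : 0 < M%:R :> R by rewrite ltr0n (leq_trans _ rM).
pose h : R := pi * r%:R / M%:R.
have s0 : sin h != 0.
  rewrite gt_eqF// sin_gt0_pi//; apply/andP; split.
    by rewrite divr_gt0// mulr_gt0 ?pi_gt0 ?ltr0n.
  by rewrite ltr_pdivrMr// ltr_pM2l ?pi_gt0 ?ltr_nat.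
have s20 : 2 * sin h != 0 by rewrite mulf_neq0 ?pnatr_eq0.
apply: (mulfI s20).
rewrite mulr0 mulr_sumr.
transitivity (\sum_(0 <= J < M) (sin (2 * h * J.+1%:R - h + a) - sin (2 * h * J%:R - h + a))).
  rewrite big_mkord; apply: eq_bigr => J _.
  have -> : 2 * pi * r%:R * J%:R / M%:R + a = 2 * h * J%:R + a by rewrite /h; ring.
  have -> : 2 * h * J.+1%:R - h + a = (2 * h * J%:R + a) + h.
    by rewrite -natr1; ring.
  have -> : 2 * h * J%:R - h + a = (2 * h * J%:R + a) - h by ring.
  by rewrite sinD sinB; ring.
rewrite (telescope_sumr (fun J => sin (2 * h * J%:R - h + a)))// mulr0 sub0r.
have -> : 2 * h * M%:R - h + a = (- h + a) + (pi *+ 2) *+ r.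
  rewrite /h -[_ *+ r]mulr_natr -[pi *+ 2]mulr_natr; field.
  by rewrite gt_eqF.
by rewrite (periodicn (@sinD2pi R)) subrr.
Qed.

Lemma sum_cos {R : realType} (M : nat) (u : int) (a : R) : (0 < M)%N ->
  \sum_(J < M) cos (2 * pi * u%:~R * J%:R / M%:R + a) =
  if (M %| u)%Z then M%:R * cos a else 0.
Proof.
move=> M0; have MR : M%:R != 0 :> R by rewrite pnatr_eq0 -lt0n.
have MZ : M%:Z != 0 by rewrite -lt0n.
have [r rE] : exists r : nat, (u %% M)%Z = r.
  have := modz_ge0 u MZ; case: (u %% M)%Z => // r _; by exists r.
have rM : (r < M)%N by rewrite -ltz_nat -rE ltz_pmod// ltz_nat.
have [z uE] : exists z : int, u = z * M%:Z + r%:Z by exists (u %/ M)%Z; rewrite -rE -divz_eq.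
have e (J : 'I_M) : cos (2 * pi * u%:~R * J%:R / M%:R + a) =
    cos (2 * pi * r%:R * J%:R / M%:R + a).
  rewrite -[RHS](cosD2piz _ (z * J%:Z)) uE; congr cos.
  rewrite !rmorphD/= !rmorphM/= -!pmulrn; field.
  by rewrite MR.
under eq_bigr do rewrite e.
have [d|nd] := ifPn.
  have -> : r = 0%N by move/dvdz_mod0P: d; rewrite rE => -[].
  
  under eq_bigr do rewrite mulr0 !mul0r add0r.
  by rewrite sumr_const card_ord mulr_natl.
apply: sum_cos_nat; rewrite rM andbT lt0n; apply: contra nd => /eqP r0.
by apply/dvdz_mod0P; rewrite rE r0.
Qed.

(** For [M <= 4 k] the angle lies in [[pi/4, pi/2]], where the sine is at least [1/2 >= k / M].
    Otherwise [sin (2 t) = 2 sin t cos t <= 2 sin t] transfers the bound from [2 k] to [k]. *)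
Lemma sin_pi_frac_ge {R : realType} (M k : nat) : (0 < k)%N -> (2 * k <= M)%N ->
  k%:R / M%:R <= sin (pi * k%:R / M%:R) :> R.
Proof.
move=> k0 kM; have M0 : 0 < M%:R :> R by rewrite ltr0n; lia.
have pi0 := @pi_gt0 R.
(* The induction runs on a bound for [M - k], which doubling [k] decreases. *)
move: {2}(M - k)%N (leqnn (M - k)%N) => n; elim: n k k0 kM => [|n IH] k k0 kM Mk.
  by exfalso; lia.
have x0 : 0 < pi * k%:R / M%:R :> R by rewrite divr_gt0// mulr_gt0// ltr0n.
have xh : pi * k%:R / M%:R <= pi / 2 :> R.
  rewrite ler_pdivrMr// mulrAC ler_pdivlMr// -mulrA ler_pM2l//.
  by rewrite -natrM ler_nat mulnC.
have [k4|k4] := leqP M (4 * k).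
  have sq : 1 / 2 <= sin (pi / 4) :> R.
    have := sin_pihalf R; have -> : pi / 2 = (pi / 4) *+ 2 :> R by rewrite -mulr_natr; field.
    rewrite sin_mulr2n -mulr_natr => e.
    have := cos_le1 (pi / 4 : R).
    have : 0 < sin (pi / 4) :> R by apply: sin_gt0_pihalf; lra.
    nra.
  apply: (@le_trans _ _ (1 / 2)).
    by rewrite ler_pdivrMr// mulrAC ler_pdivlMr// mul1r -natrM ler_nat mulnC.
  apply: (le_trans sq).
  have q : pi / 4 <= pi * k%:R / M%:R :> R.
    rewrite ler_pdivlMr// mulrAC ler_pdivrMr// -mulrA ler_pM2l//.
    by rewrite -natrM ler_nat mulnC.
  rewrite leNgt ltr_sin ?in_itv/= -?leNgt//; lra.
have := IH (2 * k)%N; rewrite muln_gt0 k0/= => /(_ isT).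
have -> : pi * (2 * k)%:R / M%:R = (pi * k%:R / M%:R) *+ 2 :> R.
  by rewrite natrM -[RHS]mulr_natr; ring.
rewrite sin_mulr2n -[_ *+ 2]mulr_natr natrM => h.
have {}h := h ltac:(lia) ltac:(lia).
have := cos_le1 (pi * k%:R / M%:R : R).
have : 0 < sin (pi * k%:R / M%:R) :> R by apply: sin_gt0_pi; lra.
have : 2 * k%:R / M%:R = 2 * (k%:R / M%:R) :> R by rewrite mulrA.
nra.
Qed.

(** The square is expanded and each product of cosines is turned into a sum. Summed over [J], only
    frequencies equal up to sign modulo [M] survive; since [g >= 0], the remaining phases are
    bounded by [cos <= 1]. *)
Lemma sum_sqr_cos {R : realType} (I : finType) (M : nat) (u : I -> nat)
    (g a : I -> R) : (0 < M)%N -> (forall p, 0 <= g p) ->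
  \sum_(J < M) (\sum_p g p * cos (2 * pi * (u p)%:R * J%:R / M%:R + a p)) ^+ 2 <=
  M%:R / 2 * \sum_p \sum_p' g p * (g p' *
    ((u p' == u p %[mod M])%:R + (u p + u p' == 0 %[mod M])%:R)).
Proof.
move=> M0 g0.
under eq_bigr do rewrite expr2 big_distrlr/=.
rewrite exchange_big/= mulr_sumr; apply: ler_sum => p _.
rewrite exchange_big/= mulr_sumr; apply: ler_sum => p' _.
rewrite [leRHS](_ : _ = g p * g p' * (M%:R / 2 *
    ((u p' == u p %[mod M])%:R + (u p + u p' == 0 %[mod M])%:R))); last by ring.
rewrite [leLHS](_ : _ = g p * g p' / 2 *
   (\sum_(J < M) cos (2 * pi * ((u p')%:Z - (u p)%:Z)%:~R * J%:R / M%:R + (a p' - a p)) +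
    \sum_(J < M) cos (2 * pi * (u p + u p')%:Z%:~R * J%:R / M%:R + (a p + a p')))).
  rewrite -mulrA; apply: ler_wpM2l; first exact: mulr_ge0.
  rewrite !sum_cos//.
  have le1 (b : bool) (b' : bool) y : b = b' ->
      2^-1 * (if b then M%:R * cos y else 0) <= M%:R / 2 * b'%:R :> R.
    move=> <-; case: b; rewrite ?mulr0// mulr1 mulrC ler_wpM2r//.
    by rewrite ler_piMr ?cos_le1.
  rewrite [leLHS]mulrDr [leRHS]mulrDr lerD// le1//.
    by rewrite -eqz_mod_dvd -!eqz_nat !modz_nat.
  by rewrite dvdzE/= mod0n.
rewrite -big_split/= mulr_sumr; apply: eq_bigr => J _.
set A := 2 * pi * (u p)%:R * J%:R / M%:R + a p.
set B := 2 * pi * (u p')%:R * J%:R / M%:R + a p'.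
have -> : 2 * pi * ((u p')%:Z - (u p)%:Z)%:~R * J%:R / M%:R + (a p' - a p) = B - A.
  by rewrite rmorphB/= -!pmulrn /A /B; ring.
have -> : 2 * pi * (u p + u p')%:Z%:~R * J%:R / M%:R + (a p + a p') = A + B.
  by rewrite -!pmulrn natrD /A /B; ring.
by move: A B => A B; rewrite cosB cosD; field.
Qed.

(** * Weights of Fourier coefficients and their sums along congruences *)

Section frequency_weights.
Context {R : realType}.

Definition harmonic_sum (M : nat) : R := \sum_(1 <= k < M) k%:R^-1.

(** A majorant of the coefficient [1 / (2 M sin (pi xi / M))] of an arc: the first term handles
    [xi <= M / 2], the second the reflected range. The value 0 at [xi = 0] reflects that the mean is
    subtracted. *)
Definition freq_weight (M xi : nat) : R :=
  if xi == 0%N then 0 else (xi%:R^-1 + (M - xi)%:R^-1) / 2.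

Lemma harmonic_sum_ge0 M : 0 <= harmonic_sum M.
Proof. by apply: sumr_ge0 => k _; rewrite invr_ge0. Qed.

Lemma freq_weight_ge0 M xi : 0 <= freq_weight M xi.
Proof.
by rewrite /freq_weight; case: ifP => // _; rewrite divr_ge0// addr_ge0// invr_ge0.
Qed.

Lemma sum_inv_multiples (d M : nat) : (0 < d)%N -> (d %| M)%N ->
  \sum_(1 <= xi < M | (d %| xi)%N) xi%:R^-1 <= d%:R^-1 * harmonic_sum M.
Proof.
move=> d0 /dvdnP[m ->].
have [->|m0] := posnP m.
  by rewrite mul0n big_geq// mulr_ge0 ?invr_ge0 ?harmonic_sum_ge0.
have -> : \sum_(1 <= xi < m * d | (d %| xi)%N) xi%:R^-1 =
    \sum_(0 <= xi < m * d | (d %| xi)%N) xi%:R^-1 :> R.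
  by rewrite [RHS]big_ltn_cond ?muln_gt0 ?m0// dvdn0 invr0 add0r.
(* In each block of length [d] only the first entry is a multiple of [d]. *)
rewrite big_mkcond big_nat_mul/= (eq_bigr (fun i => d%:R^-1 * i%:R^-1)); last first.
  move=> i _; rewrite -{1}[(i * d)%N]add0n big_addn mulSn addnK big_ltn//.
  rewrite add0n dvdn_mull// natrM invfM big_nat big1 ?addr0 1?mulrC// => j.
  by rewrite dvdn_addl ?dvdn_mull// => /andP[j0 jd]; rewrite gtnNdvd.
rewrite -mulr_sumr ler_wpM2l ?invr_ge0// big_ltn// invr0 add0r.
rewrite /harmonic_sum [leRHS](@big_cat_nat _ _ _ m)//= ?leq_pmulr//.
by rewrite lerDl sumr_ge0// => k _; rewrite invr_ge0.
Qed.

Lemma sum_freq_weight_multiples (d M : nat) : (0 < d)%N -> (d %| M)%N -> (0 < M)%N ->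
  \sum_(xi < M | (d %| xi)%N) freq_weight M xi <= d%:R^-1 * harmonic_sum M.
Proof.
move=> d0 dM M0; apply: le_trans (sum_inv_multiples d0 dM).
rewrite -(big_mkord (fun xi => d %| xi)%N (freq_weight M)) big_ltn_cond//.
rewrite dvdn0 {1}/freq_weight eqxx add0r.
rewrite big_nat_cond (eq_bigr (fun xi => (xi%:R^-1 + (M - xi)%:R^-1) / 2)); last first.
  by move=> xi /andP[/andP[xi0 _] _]; rewrite /freq_weight gtn_eqF.
rewrite -big_nat_cond -mulr_suml big_split/=.
(* The reflection [xi -> M - xi] preserves the multiples of [d] because [d] divides [M]. *)
rewrite [X in (_ + X) / 2](_ : _ = \sum_(1 <= xi < M | (d %| xi)%N) xi%:R^-1); last first.
  rewrite [LHS]big_nat_rev/= big_nat_cond [RHS]big_nat_cond.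
  apply: eq_big => xi.
    case: (boolP (0 < xi < M)%N) => //= /andP[x0 xM].
    by rewrite add1n subSS dvdn_subr// ltnW.
  by move=> /andP[/andP[x0 xM] _]; rewrite add1n subSS subKn// ltnW.
by rewrite mulrDl -splitr.
Qed.

Lemma sum_freq_weight M : (0 < M)%N ->
  \sum_(xi < M) freq_weight M xi <= harmonic_sum M.
Proof.
move=> M0; have := @sum_freq_weight_multiples 1 M isT (dvd1n _) M0.
by rewrite invr1 mul1r; under eq_bigl do rewrite dvd1n.
Qed.

(** As 2 is invertible modulo 3, every nonzero [xi] with a solution [n] has the 3-adic valuation [a]
    of [gcd(b, M)]. Such a [xi] has at most [4 * 3 ^ a] solutions, while the multiples of [3 ^ a]
    carry weight only [3 ^ (- a)] times the harmonic sum; the two powers cancel. *)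
Lemma sum_freq_weight_solutions q N b : (N <= 3 ^ q)%N ->
  \sum_(n < N) \sum_(xi < 3 ^ q)
    freq_weight (3 ^ q) xi * (2 ^ n * xi == b %[mod 3 ^ q])%:R <=
  4 * harmonic_sum (3 ^ q).
Proof.
move=> Nq; set M := (3 ^ q)%N; have M0 : (0 < M)%N by rewrite expn_gt0.
pose a := logn 3 (gcdn b M).
have g0 : (0 < gcdn b M)%N by rewrite gcdn_gt0 M0 orbT.
have aM : (3 ^ a %| M)%N by apply: dvdn_trans (dvdn_gcdr b M); exact: pfactor_dvdnn.
have aE (n xi : nat) : (0 < xi < M)%N -> 2 ^ n * xi = b %[mod M] -> logn 3 xi = a.
  move=> /andP[x0 xM] e.
  rewrite /a -gcdn_modl -e gcdn_modl gcdnC Gauss_gcdr; last first.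
    by rewrite coprimeXl// coprimeXr.
  rewrite logn_gcd// lognX/= muln1; apply/esym/minn_idPr/ltnW.
  rewrite -(ltn_exp2l _ _ (isT : 1 < 3)%N); apply: leq_ltn_trans xM.
  by rewrite dvdn_leq// pfactor_dvdnn.
rewrite exchange_big/= [X in 4 * X](_ : _ = (3 ^ a)%:R * ((3 ^ a)%:R^-1 * harmonic_sum M)); last first.
  by rewrite mulVKf// pnatr_eq0 expn_eq0.
rewrite [leRHS]mulrA.
apply: (@le_trans _ _ (4 * (3 ^ a)%:R * \sum_(xi < M | (3 ^ a %| xi)%N) freq_weight M xi)); last first.
  by rewrite ler_wpM2l ?mulr_ge0// sum_freq_weight_multiples ?expn_gt0.
rewrite mulr_sumr [leRHS]big_mkcond; apply: ler_sum => xi _.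
rewrite -mulr_sumr.
have [->|x0] := posnP xi.
  by rewrite /freq_weight eqxx mul0r mulr0; case: ifP.
have xM : (0 < xi < M)%N by rewrite x0 ltn_ord.
have cardE : \sum_(n < N) (2 ^ n * xi == b %[mod M])%:R =
    #|[pred n : 'I_N | 2 ^ n * xi == b %[mod M]]|%:R :> R.
  rewrite -natr_sum -sum1_card [in RHS]big_mkcond/=; congr _%:R.
have [e|ne] := pickP [pred n : 'I_N | 2 ^ n * xi == b %[mod M]]; last first.
  rewrite cardE eq_card0// mulr0.
  by case: ifP => _ //; rewrite !mulr_ge0 ?freq_weight_ge0.
move=> /eqP /(aE _ _ xM) xa.
rewrite -xa pfactor_dvdnn mulrC ler_wpM2r ?freq_weight_ge0// cardE.
by rewrite -natrM ler_nat card_dilation_solutions.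
Qed.

(* Two frequencies 2 ^ n xi and 2 ^ n' xi' interact only when they agree up to
   sign modulo 3 ^ q; since 2 has order 2 * 3 ^ (k - 1) modulo 3 ^ k, this is
   rare on average. *)
Lemma dilated_cos_second_moment q N (g a : nat -> nat -> R) : (N <= 3 ^ q)%N ->
  (forall n xi, 0 <= g n xi <= freq_weight (3 ^ q) xi) ->
  \sum_(J < 3 ^ q) (\sum_(n < N) \sum_(xi < 3 ^ q)
    g n xi * cos (2 * pi * (2 ^ n * xi)%:R * J%:R / (3 ^ q)%:R + a n xi)) ^+ 2 <=
  4 * (3 ^ q)%:R * N%:R * harmonic_sum (3 ^ q) ^+ 2.
Proof.
move=> Nq gG; set M := (3 ^ q)%N; have M0 : (0 < M)%N by rewrite expn_gt0.
have g0 n xi : 0 <= g n xi by case/andP: (gG n xi).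
have gle n xi : g n xi <= freq_weight M xi by case/andP: (gG n xi).
under eq_bigr do rewrite pair_bigA/=.
have := @sum_sqr_cos R ('I_N * 'I_M)%type M (fun p => 2 ^ p.1 * p.2)%N
  (fun p => g p.1 p.2) (fun p => a p.1 p.2) M0 (fun p => g0 _ _).
move=> /le_trans; apply.
set H := harmonic_sum M.
have half b : \sum_(p' : 'I_N * 'I_M) g p'.1 p'.2 * (2 ^ p'.1 * p'.2 == b %[mod M])%:R <= 4 * H.
  rewrite -(pair_bigA _ (fun (n : 'I_N) (xi : 'I_M) => g n xi * (2 ^ n * xi == b %[mod M])%:R))/=.
  apply: le_trans (sum_freq_weight_solutions b Nq).
  by apply: ler_sum => n _; apply: ler_sum => xi _; rewrite ler_wpM2r.
have -> : 4 * M%:R * N%:R * H ^+ 2 = M%:R / 2 * (N%:R * H * (2 * (4 * H))) by field.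
apply: ler_wpM2l; first by rewrite divr_ge0.
apply: (@le_trans _ _ (\sum_(p : 'I_N * 'I_M) g p.1 p.2 * (2 * (4 * H)))).
  apply: ler_sum => p _; rewrite -mulr_sumr; apply: ler_wpM2l => //.
  under eq_bigr do rewrite mulrDr.
  rewrite big_split/= [2 * _]mulr_natl mulr2n lerD ?half//.
  (* The coincidence with opposite sign is a congruence to the negated residue, so [half] applies a
     second time. *)
  apply: le_trans (half (M - (2 ^ p.1 * p.2) %% M)%N).
  apply: ler_sum => p' _; rewrite ler_wpM2l// ler_nat.
  case: (boolP (_ == 0 %[mod M])) => //= /eqP e.
  have rM : ((2 ^ p.1 * p.2) %% M <= M)%N by rewrite ltnW// ltn_mod.
  rewrite -(eqn_modDl ((2 ^ p.1 * p.2) %% M)) subnKC// modnDml e.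
  by rewrite mod0n modnn.
rewrite -mulr_suml ler_wpM2r ?mulr_ge0 ?harmonic_sum_ge0//.
rewrite -(pair_bigA _ (fun (n : 'I_N) (xi : 'I_M) => g n xi))/=.
apply: (@le_trans _ _ (\sum_(n < N) H)); last by rewrite sumr_const card_ord mulr_natl.
apply: ler_sum => n _; apply: le_trans (sum_freq_weight M0).
by apply: ler_sum => xi _.
Qed.

End frequency_weights.

(** * Arcs modulo a power of 3 *)

(** The bound [sin (pi k / M) >= k / M] is used at [k = xi] if [2 xi <= M] and at [k = M - xi]
    otherwise, by the symmetry of the sine about [pi / 2]. *)
Lemma freq_coef_bounds {R : realType} (M xi : nat) : (0 < xi < M)%N ->
  0 < 2 * M%:R * sin (pi * xi%:R / M%:R) :> R /\
  (2 * M%:R * sin (pi * xi%:R / M%:R))^-1 <= freq_weight M xi :> R.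
Proof.
move=> /andP[x0 xM]; have M0 : 0 < M%:R :> R by rewrite ltr0n; lia.
have kE (k : nat) : (0 < k)%N -> k%:R / M%:R <= sin (pi * xi%:R / M%:R) :> R ->
    0 < 2 * M%:R * sin (pi * xi%:R / M%:R) :> R /\
    (2 * M%:R * sin (pi * xi%:R / M%:R))^-1 <= k%:R^-1 / 2 :> R.
  move=> k0; rewrite ler_pdivrMr// mulrC => h.
  have k0R : 0 < k%:R :> R by rewrite ltr0n.
  have p0 : 0 < M%:R * sin (pi * xi%:R / M%:R) :> R by exact: lt_le_trans h.
  rewrite -mulrA; split; first by rewrite mulr_gt0.
  rewrite -invfM lef_pV2 ?posrE; [|exact: mulr_gt0..].
  by rewrite mulrC ler_wpM2l.
rewrite /freq_weight gtn_eqF//.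
have [xs|xs] := leqP (2 * xi) M.
  have [s0 /le_trans sle] := kE _ x0 (sin_pi_frac_ge x0 xs).
  by split=> //; apply: sle; rewrite ler_wpM2r// lerDl invr_ge0.
have y0 : (0 < M - xi)%N by rewrite subn_gt0.
have := @sin_pi_frac_ge R M (M - xi) y0 ltac:(lia).
have -> : pi * (M - xi)%:R / M%:R = - (pi * xi%:R / M%:R) + pi :> R.
  by rewrite natrB ?(ltnW xM)//; field; rewrite gt_eqF.
rewrite (@sinDpi R) sinN opprK => /(kE _ y0)[s0 /le_trans sle].
by split=> //; apply: sle; rewrite ler_wpM2r// lerDr invr_ge0.
Qed.

Lemma dvdz_indicator {R : realType} (M : nat) (u : int) : (0 < M)%N ->
  (M %| u)%Z%:R - M%:R^-1 =
  M%:R^-1 * \sum_(1 <= xi < M) cos (2 * pi * u%:~R * xi%:R / M%:R) :> R.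
Proof.
move=> M0; have MR : M%:R != 0 :> R by rewrite pnatr_eq0 -lt0n.
have := @sum_cos R M u 0 M0.
under eq_bigr do rewrite addr0.
rewrite -(big_mkord xpredT (fun J => cos (2 * pi * u%:~R * J%:R / M%:R))) big_ltn//.
rewrite mulr0 mul0r cos0 mulr1 => /(canRL (addKr _)) ->.
by case: (M %| u)%Z => /=; field.
Qed.

(* The closed form of the Dirichlet kernel, cleared of the denominator sin h. *)
Lemma sum_cos_arc {R : realType} (l : nat) (h b : R) :
  2 * sin h * \sum_(i < l) cos (b - 2 * h * i%:R) =
  sin (b + h) - sin (b + h - 2 * h * l%:R).
Proof.
elim: l => [|l IH]; first by rewrite big_ord0 !mulr0 subr0 subrr.
rewrite big_ord_recr/= mulrDr {}IH -[l.+1%:R]natr1.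
have -> : b + h - 2 * h * l%:R = (b - 2 * h * l%:R) + h by ring.
have -> : b + h - 2 * h * (l%:R + 1) = (b - 2 * h * l%:R) - h by ring.
by rewrite [sin (_ - _ + h)]sinD [sin (_ - h)]sinB; ring.
Qed.

Definition in_arc (M : nat) (j : int) (l : nat) (K : int) : bool :=
  [exists i : 'I_l, (M %| K - j - i%:Z)%Z].

(** Since [l <= M], the offsets are distinct modulo [M], so at most one summand is 1. *)
Lemma in_arc_sum {R : realType} (M : nat) (j : int) (l : nat) (K : int) : (l <= M)%N ->
  (in_arc M j l K)%:R = \sum_(i < l) (M %| K - j - i%:Z)%Z%:R :> R.
Proof.
move=> lM; rewrite /in_arc; case: existsP => [[i0 h0]|no]; last first.
  by rewrite big1// => i _; case: (boolP (M %| _)%Z) => // h; case: no; exists i.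
rewrite (bigD1 i0)//= h0 big1 ?addr0// => i ii0.
apply/eqP; rewrite pnatr_eq0 eqb0; apply: contra ii0 => h.
have : (M %| (K - j - i%:Z) - (K - j - i0%:Z))%Z by rewrite rpredB.
have -> : (K - j - i%:Z) - (K - j - i0%:Z) = i0%:Z - i%:Z by ring.
rewrite -eqz_mod_dvd !modz_nat eqz_nat eq_sym.
by rewrite !modn_small ?(leq_trans (ltn_ord _) lM)// => /eqP e; apply/eqP/val_inj.
Qed.

(** Subtracting [l / M] removes the frequency 0. Summing a character over the arc by [sum_cos_arc]
    leaves one sine for each end of the arc; the shift [1/2] is the [+ h] of the Dirichlet
    kernel. *)
Lemma in_arc_fourier {R : realType} (M : nat) (j : int) (l : nat) (K : int) :
  (0 < M)%N -> (l <= M)%N ->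
  (in_arc M j l K)%:R - l%:R / M%:R =
  \sum_(1 <= xi < M) (2 * M%:R * sin (pi * xi%:R / M%:R))^-1 *
    (sin (2 * pi * xi%:R * (K%:~R - j%:~R + 2^-1) / M%:R) -
     sin (2 * pi * xi%:R * (K%:~R - j%:~R - l%:R + 2^-1) / M%:R)) :> R.
Proof.
move=> M0 lM; have MR : M%:R != 0 :> R by rewrite pnatr_eq0 -lt0n.
rewrite in_arc_sum//.
have -> : l%:R / M%:R = \sum_(i < l) M%:R^-1 :> R.
  by rewrite sumr_const card_ord mulr_natl.
rewrite -sumrB.
under eq_bigr do rewrite dvdz_indicator//.
rewrite -mulr_sumr exchange_big/= mulr_sumr [LHS]big_nat [RHS]big_nat.
apply: eq_bigr => xi xM; have [s0 _] := @freq_coef_bounds R _ _ xM.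
set h := pi * xi%:R / M%:R in s0 *.
have -> : \sum_(i < l) cos (2 * pi * (K - j - i%:Z)%:~R * xi%:R / M%:R) =
   \sum_(i < l) cos (2 * h * (K%:~R - j%:~R) - 2 * h * i%:R) :> R.
  by apply: eq_bigr => i _; congr cos; rewrite !rmorphB/= /h; ring.
have -> : 2 * pi * xi%:R * (K%:~R - j%:~R + 2^-1) / M%:R =
   2 * h * (K%:~R - j%:~R) + h :> R by rewrite /h; field.
have -> : 2 * pi * xi%:R * (K%:~R - j%:~R - l%:R + 2^-1) / M%:R =
   2 * h * (K%:~R - j%:~R) + h - 2 * h * l%:R :> R by rewrite /h; field.
rewrite -sum_cos_arc; field.
by rewrite MR andbT; apply/eqP => s; rewrite s mulr0 ltxx in s0.
Qed.

Lemma arcs_second_moment {R : realType} q m N (j : nat -> int) (l : nat -> nat) :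
  (N <= 3 ^ q)%N -> (forall n, (l n <= 3 ^ q)%N) ->
  \sum_(J < 3 ^ q) (\sum_(m <= n < N)
     ((in_arc (3 ^ q) (j n) (l n) (2 ^ n * J)%N)%:R - (l n)%:R / (3 ^ q)%:R)) ^+ 2 <=
  16 * (3 ^ q)%:R * N%:R * harmonic_sum (3 ^ q) ^+ 2 :> R.
Proof.
move=> Nq lM; set M := (3 ^ q)%N; have M0 : (0 < M)%N by rewrite expn_gt0.
have MR : M%:R != 0 :> R by rewrite pnatr_eq0 -lt0n.
pose c xi : R := if xi == 0%N then 0 else (2 * M%:R * sin (pi * xi%:R / M%:R))^-1.
(* Cut off outside the range, so that the majorant holds for all [n] and [xi]. *)
pose g (n xi : nat) : R := if (m <= n)%N && (xi < M)%N then c xi else 0.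
(* The values [b = 0] and [b = 1] give the phases at the two ends of the arc; [- pi / 2] turns sines
   into cosines. *)
pose a (b : R) (n xi : nat) : R :=
  2 * pi * xi%:R * (- (j n)%:~R - b * (l n)%:R + 2^-1) / M%:R - pi / 2.
pose F b (J : nat) : R := \sum_(n < N) \sum_(xi < M)
    g n xi * cos (2 * pi * (2 ^ n * xi)%:R * J%:R / M%:R + a b n xi).
have gG n xi : 0 <= g n xi <= freq_weight M xi.
  rewrite /g /c; case: ifP => [/andP[_ xM]|]; last by rewrite lexx freq_weight_ge0.
  case: (posnP xi) => [->|x0]; first by rewrite /freq_weight/= lexx.
  have [s0 ->] := @freq_coef_bounds R M xi ltac:(by rewrite x0).
  by rewrite invr_ge0 ltW.
have Fmoment b : \sum_(J < M) F b J ^+ 2 <= 4 * M%:R * N%:R * harmonic_sum M ^+ 2.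
  exact: dilated_cos_second_moment.
(* The two ends are separated by [(u - v) ^ 2 <= 2 u ^ 2 + 2 v ^ 2], whence [16 = 2 * 4 + 2 * 4]. *)
have -> : 16 * M%:R * N%:R * harmonic_sum M ^+ 2 =
  2 * (4 * M%:R * N%:R * harmonic_sum M ^+ 2) + 2 * (4 * M%:R * N%:R * harmonic_sum M ^+ 2) :> R.
  by ring.
apply: le_trans (lerD (ler_wpM2l _ (Fmoment 0)) (ler_wpM2l _ (Fmoment 1))) => //.
rewrite !mulr_sumr -big_split/=; apply: ler_sum => J _.
suff -> : \sum_(m <= n < N) ((in_arc M (j n) (l n) (2 ^ n * J)%N)%:R - (l n)%:R / M%:R)
    = F 0 J - F 1 J.
  by have := sqr_ge0 (F 0 J + F 1 J); nra.
rewrite /F -sumrB (big_nat_widenl _ 0%N)// big_mkord big_mkcond/=.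
apply: eq_bigr => n _; rewrite /g; case: ifP => mn /=; last first.
  by rewrite !big1 ?subrr// => xi _; rewrite mul0r.
rewrite in_arc_fourier// -sumrB.
rewrite -(big_mkord xpredT (fun xi => (if (xi < M)%N then c xi else 0) * cos (2 * pi * (2 ^ n * xi)%:R * J%:R / M%:R + a 0 n xi) -
   (if (xi < M)%N then c xi else 0) * cos (2 * pi * (2 ^ n * xi)%:R * J%:R / M%:R + a 1 n xi))).
rewrite [RHS]big_ltn// M0 {1 2}/c eqxx !mul0r subrr add0r [LHS]big_nat [RHS]big_nat.
apply: eq_bigr => xi /andP[x0 xM]; rewrite xM -mulrBr /c gtn_eqF//.
rewrite -!cosBpihalf -!pmulrn; congr (_ * (cos _ - cos _)).
  by rewrite /a !natrM; field.
by rewrite /a !natrM; field.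
Qed.

(** * Neighbourhoods of the integers as arcs *)

Definition near_int {R : realType} (x theta : R) : bool :=
  `[< exists p : int, `|x - p%:~R| <= theta >].

Lemma int_segment_enum (j h t : int) (l : nat) : h + 1 - j = l%:Z ->
  (j <= t <= h) = [exists i : 'I_l, t - j == i%:Z].
Proof.
move=> lE; apply/idP/existsP => [/andP[jt th]|[i /eqP e]].
  have il : (`|(t - j)%R|%N < l)%N by lia.
  by exists (Ordinal il); apply/eqP => /=; lia.
by have := ltn_ord i; lia.
Qed.

(** Nearness to [p] says that [K - p M] lies in [[A, A + 2 theta M]] with [A = - M (y + theta)]. The
    integers of this interval are consecutive, and their number [l] differs from the length by at
    most 1; [theta <= 1/3] and [M >= 3] give [l <= M]. *)
Lemma near_int_arc {R : realType} (M : nat) (y theta : R) :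
  (3 <= M)%N -> 0 <= theta <= 1 / 3 ->
  exists j l, [/\ (l <= M)%N, `|l%:R - 2 * theta * M%:R| <= 1 &
    forall K : nat, near_int (K%:R / M%:R + y) theta = in_arc M j l K].
Proof.
move=> M3 /andP[t0 t3].
have M3R : 3 <= M%:R :> R by rewrite ler_nat.
have M0 : 0 < M%:R :> R by lra.
pose A := - M%:R * (y + theta).
have [Al Au] : (Num.ceil A)%:~R - 1 < A /\ A <= (Num.ceil A)%:~R.
  by rewrite Num.Theory.ceil_ge; have := Num.Theory.gt_pred_ceil A; rewrite rmorphB.
have [Bl Bu] : (Num.floor (A + 2 * theta * M%:R))%:~R <= A + 2 * theta * M%:R /\
    A + 2 * theta * M%:R < (Num.floor (A + 2 * theta * M%:R))%:~R + 1.
  rewrite Num.Theory.ge_floor; have := Num.Theory.floorD1_gt (A + 2 * theta * M%:R).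
  by rewrite rmorphD.
set j := Num.ceil A in Al Au; set h := Num.floor (A + 2 * theta * M%:R) in Bl Bu.
have tM : 0 <= theta * M%:R by rewrite mulr_ge0// ltW.
(* The interval may contain no integer; then [j = h + 1] and [l = 0]. *)
have jh : (j < h + 2)%R by rewrite -(ltr_int R) rmorphD/=; lra.
have [l lE] : exists l : nat, h + 1 - j = l%:Z.
  have : 0 <= h + 1 - j by lia.
  by case: (h + 1 - j) => // l _; exists l.
have lR : l%:R = h%:~R + 1 - j%:~R :> R.
  by rewrite -[l%:R]/(l%:Z%:~R) -lE rmorphB rmorphD.
exists j, l; split.
- rewrite -(ler_nat R) lR; have : theta * M%:R <= 1 / 3 * M%:R by rewrite ler_wpM2r// ltW.
  lra.
- by rewrite lR ler_norml; apply/andP; split; lra.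
move=> K; apply/asboolP/existsP => [[p]|[i /dvdzP[p e]]].
  rewrite ler_norml => /andP[h1 h2].
  have eK : K%:R = K%:R / M%:R * M%:R :> R by rewrite divfK ?gt_eqF.
  have k1 : A <= (K%:Z - p * M%:Z)%:~R.
    rewrite rmorphB rmorphM/= -!pmulrn /A eK.
    have : 0 <= (K%:R / M%:R + y - p%:~R + theta) * M%:R by rewrite mulr_ge0 ?(ltW M0)//; lra.
    lra.
  have k2 : (K%:Z - p * M%:Z)%:~R <= A + 2 * theta * M%:R.
    rewrite rmorphB rmorphM/= -!pmulrn /A eK.
    have : 0 <= (theta - (K%:R / M%:R + y - p%:~R)) * M%:R by rewrite mulr_ge0 ?(ltW M0)//; lra.
    lra.
  have j1 : j <= K%:Z - p * M%:Z by rewrite /j Num.Theory.ceil_le_int.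
  have j2 : K%:Z - p * M%:Z <= h by rewrite /h Num.Theory.floor_ge_int.
  have : j <= K%:Z - p * M%:Z <= h by rewrite j1 j2.
  rewrite (int_segment_enum _ lE) => /existsP[i /eqP e]; exists i.
  by apply/dvdzP; exists p; rewrite addrAC -e; ring.
exists p.
have : j <= K%:Z - p * M%:Z <= h.
  rewrite (int_segment_enum _ lE); apply/existsP; exists i; apply/eqP.
  by rewrite -e; ring.
move=> /andP[].
rewrite /j /h Num.Theory.ceil_le_int Num.Theory.floor_ge_int.
rewrite rmorphB rmorphM/= -!pmulrn /A => j1 j2.
have eK : K%:R / M%:R + y - p%:~R = (K%:R - p%:~R * M%:R + y * M%:R) / M%:R.
  by field; rewrite gt_eqF.
by rewrite eK ler_norml ler_pdivlMr// ler_pdivrMr//; apply/andP; split; lra.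
Qed.

Lemma uniform_second_moment {R : realType} q m N (y theta : nat -> R) :
  (0 < q)%N -> (N <= 3 ^ q)%N -> (forall n, 0 <= theta n <= 1 / 3) ->
  \sum_(J < 3 ^ q) (\sum_(m <= n < N)
     ((near_int (2 ^+ n * (J%:R / (3 ^ q)%:R) + y n) (theta n))%:R - 2 * theta n)) ^+ 2 <=
  32 * (3 ^ q)%:R * N%:R * harmonic_sum (3 ^ q) ^+ 2 + 2 * (3 ^ q)%:R :> R.
Proof.
move=> q0 Nq t01; set M := (3 ^ q)%N.
have M3 : (3 <= M)%N by rewrite -{1}(expn1 3) leq_exp2l.
have M0 : 0 < M%:R :> R by rewrite ltr0n; lia.
have /choice[jl jlP] : forall n, exists jl : int * nat,
    [/\ (jl.2 <= M)%N, `|jl.2%:R - 2 * theta n * M%:R| <= 1 &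
    forall K : nat, near_int (K%:R / M%:R + y n) (theta n) = in_arc M jl.1 jl.2 K].
  by move=> n; have [j [l ?]] := near_int_arc (y n) M3 (t01 n); exists (j, l).
have lM n : ((jl n).2 <= M)%N by case: (jlP n).
have := @arcs_second_moment R q m N (fun n => (jl n).1) (fun n => (jl n).2) Nq lM.
rewrite -/M; set X := 16 * _ * _ * _.
have -> : 32 * M%:R * N%:R * harmonic_sum M ^+ 2 = 2 * X by rewrite /X; ring.
move=> /(ler_wpM2l (_ : 0 <= 2)) => /(_ (ler0n _ 2)) le1.
rewrite [X in _ <= _ + 2 * X](_ : M%:R = \sum_(J < M) 1 :> R); last first.
  by rewrite sumr_const card_ord.
apply: le_trans (lerD le1 (lexx _)).
rewrite [2 * \sum_(J < M) 1]mulr_sumr mulr_sumr -big_split/=; apply: ler_sum => J _.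
set S1 := \sum_(m <= n < N) _; set S2 := \sum_(m <= n < N) _.
(* Replacing [2 theta n] by [l n / M] costs at most [1 / M] for each of at most [N <= M] indices.
   Then [S1 ^ 2 <= 2 S2 ^ 2 + 2]. *)
suff : `|S1 - S2| <= 1.
  rewrite ler_norml => /andP[h1 h2]; have : (S1 - S2) ^+ 2 <= 1 by nra.
  have := sqr_ge0 (S1 - 2 * S2); nra.
rewrite /S1 /S2 -sumrB.
apply: (@le_trans _ _ (\sum_(m <= n < N) M%:R^-1)).
  apply: le_trans (ler_norm_sum _ _ _) _; apply: ler_sum => n _.
  have [_ h1 h2] := jlP n.
  have -> : 2 ^+ n * (J%:R / M%:R) = (2 ^ n * J)%:R / M%:R :> R.
    by rewrite natrM natrX mulrA.
  rewrite h2; set b := (in_arc _ _ _ _)%:R.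
  have -> : b - 2 * theta n - (b - (jl n).2%:R / M%:R) = ((jl n).2%:R - 2 * theta n * M%:R) / M%:R.
    by field; rewrite gt_eqF.
  by rewrite normrM (@ger0_norm _ M%:R^-1) ?invr_ge0 ?ler0n// ler_piMl ?invr_ge0.
rewrite sumr_const_nat -[_ *+ (_ - _)]mulr_natl ler_pdivrMr// mul1r ler_nat.
by apply: leq_trans (leq_subr _ _) Nq.
Qed.

(** Each block from [3 ^ q] to [3 ^ (q + 1)] has [2 * 3 ^ q] terms of size at most [3 ^ (- q)]. *)
Lemma harmonic_sum_pow3 {R : realType} q : harmonic_sum (3 ^ q) <= 2 * q%:R :> R.
Proof.
elim: q => [|q IH]; first by rewrite /harmonic_sum big_geq// mulr0.
rewrite /harmonic_sum (@big_cat_nat _ _ _ (3 ^ q))//= ?expn_gt0//; last by rewrite leq_exp2l.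
rewrite -[q.+1%:R]natr1 mulrDr mulr1 lerD//.
have p0 : 0 < (3 ^ q)%:R :> R by rewrite ltr0n expn_gt0.
apply: (@le_trans _ _ (\sum_(3 ^ q <= k < 3 ^ q.+1) (3 ^ q)%:R^-1)).
  rewrite big_nat [leRHS]big_nat; apply: ler_sum => k /andP[k1 _].
  have k0 : (0 < k)%N by rewrite (leq_trans _ k1)// expn_gt0.
  by rewrite lef_pV2 ?posrE ?ltr0n ?expn_gt0// ler_nat.
rewrite sumr_const_nat -[_ *+ (_ - _)]mulr_natl ler_pdivrMr// -natrM ler_nat expnS; lia.
Qed.

(** * Second moments on the Cantor set *)

(* The numerators a of the left endpoints a / 3 ^ L of the intervals of the L-th
   step of the Cantor construction. *)
Fixpoint cantor_numerators (L : nat) : seq nat :=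
  if L is l.+1 then
    cantor_numerators l ++ [seq (a + 2 * 3 ^ l)%N | a <- cantor_numerators l]
  else [:: 0%N].

Lemma size_cantor_numerators L : size (cantor_numerators L) = (2 ^ L)%N.
Proof. by elim: L => //= l IH; rewrite size_cat size_map IH expnS mul2n addnn. Qed.

(** Induction on the leading ternary digit: the middle third of the range, where this digit is 1, is
    dropped. *)
Lemma sum_cantor_numerators_le {R : realType} q (F : nat -> R) :
  (forall J, 0 <= F J) ->
  \sum_(J <- cantor_numerators q) F J <= \sum_(J < 3 ^ q) F J.
Proof.
rewrite -(big_mkord xpredT F).
elim: q F => [|q IH] F F0; first by rewrite big_seq1.
rewrite [cantor_numerators _]/=.
rewrite big_cat big_map/= expnS (_ : 3 * 3 ^ q = 2 * 3 ^ q + 3 ^ q)%N; last by lia.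
rewrite (@big_cat_nat _ _ _ (2 * 3 ^ q))//= ?leq_addr//.
rewrite (@big_cat_nat _ _ _ (3 ^ q) 0%N)//= ?leq_pmull//.
rewrite -[X in _ <= _ + X]/(\sum_(2 * 3 ^ q <= i < 2 * 3 ^ q + 3 ^ q) F i).
rewrite -{3}[(2 * 3 ^ q)%N]add0n big_addn addKn; apply: lerD; last exact: IH.
by apply: le_trans (IH F F0) _; rewrite lerDl sumr_ge0.
Qed.

Lemma sum_cantor_numerators_split {R : realType} q l (F : nat -> R) :
  \sum_(a <- cantor_numerators (q + l)) F a =
  \sum_(J <- cantor_numerators q) \sum_(b <- cantor_numerators l) F (J * 3 ^ l + b)%N.
Proof.
elim: q F => [|q IH] F; first by rewrite add0n /= big_seq1.
rewrite addSn /= !big_cat !big_map/= !IH; congr (_ + _).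
apply: eq_bigr => J _; apply: eq_bigr => b _; congr F.
by rewrite mulnDl -mulnA -expnD addnAC.
Qed.

Lemma cantor_step_cover {R : realType} L (x : R) : cantor_step L x ->
  exists2 a, a \in cantor_numerators L &
    a%:R / (3 ^ L)%:R <= x <= (a%:R + 1) / (3 ^ L)%:R.
Proof.
elim: L x => [|L IH] x /=.
  by rewrite in_itv/= => h; exists 0%N; rewrite ?inE// expn0 !divr1 add0r.
have p0 : 0 < (3 ^ L)%:R :> R by rewrite ltr0n expn_gt0.
have p30 : 0 < 3 * (3 ^ L)%:R :> R by rewrite mulr_gt0.
have e : (3 ^ L.+1)%:R = 3 * (3 ^ L)%:R :> R by rewrite expnS natrM.
move=> [[y /IH[a ain /andP[]]]|[y /IH[a ain /andP[]]]];
  rewrite ler_pdivrMr// ler_pdivlMr// => h1 h2 <-.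
  exists a; first by rewrite mem_cat ain.
  by rewrite e ler_pdivrMr// ler_pdivlMr//; apply/andP; split; lra.
exists (a + 2 * 3 ^ L)%N.
  by rewrite mem_cat; apply/orP; right; apply/mapP; exists a.
by rewrite e natrD natrM ler_pdivrMr// ler_pdivlMr//; apply/andP; split; lra.
Qed.

Definition discrepancy {R : realType} (m N : nat) (theta : nat -> R) (x : R) : R :=
  \sum_(m <= n < N) ((near_int (2 ^+ n * x) (theta n))%:R - 2 * theta n).

(* Conditionally on the lower ternary digits, the top q digits are uniform on a
   subset of relative size (2 / 3) ^ q of all residues modulo 3 ^ q. *)
Lemma cantor_second_moment {R : realType} q l m N (theta : nat -> R) :
  (0 < q)%N -> (N <= 3 ^ q)%N -> (0 < N)%N -> (forall n, 0 <= theta n <= 1 / 3) ->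
  \sum_(a <- cantor_numerators (q + l))
     discrepancy m N theta (a%:R / (3 ^ (q + l))%:R) ^+ 2 <=
  (2 ^ l)%:R * (130 * (3 ^ q)%:R * N%:R * q%:R ^+ 2).
Proof.
move=> q0 Nq N0 t01; rewrite sum_cantor_numerators_split exchange_big/=.
apply: (@le_trans _ _ (\sum_(b <- cantor_numerators l) (130 * (3 ^ q)%:R * N%:R * q%:R ^+ 2))); last first.
  by rewrite big_const_seq iter_addr addr0 count_predT size_cantor_numerators -[leLHS]mulr_natl.
apply: ler_sum => b _.
apply: le_trans (sum_cantor_numerators_le _ _) _; first by move=> J; exact: sqr_ge0.
have M0 : 0 < (3 ^ q)%:R :> R by rewrite ltr0n expn_gt0.
have l0 : 0 < (3 ^ l)%:R :> R by rewrite ltr0n expn_gt0.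
(* The fixed lower digits [b] enter only through the translations [y n]. *)
have := @uniform_second_moment R q m N (fun n => 2 ^+ n * (b%:R / (3 ^ (q + l))%:R)) theta q0 Nq t01.
under eq_bigr => J _.
  under eq_bigr => n _.
    rewrite -mulrDr (_ : J%:R / (3 ^ q)%:R + b%:R / (3 ^ (q + l))%:R =
      (J * 3 ^ l + b)%:R / (3 ^ (q + l))%:R); last first.
      by rewrite natrD natrM expnD natrM; field; rewrite !gt_eqF.
    over.
  over.
move=> /le_trans; apply.
have H0 := @harmonic_sum_ge0 R (3 ^ q); have H1 := @harmonic_sum_pow3 R q.
have N1 : 1 <= N%:R :> R by rewrite ler1n.
have q1 : 1 <= q%:R :> R by rewrite ler1n.
(* With this bound the constant becomes [130 = 32 * 4 + 2]. *)
have HH : harmonic_sum (3 ^ q) ^+ 2 <= 4 * q%:R ^+ 2 :> R by nra.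
have MN : 0 <= (3 ^ q)%:R * N%:R :> R by rewrite mulr_ge0.
have : (3 ^ q)%:R <= (3 ^ q)%:R * N%:R * q%:R ^+ 2 :> R.
  by rewrite -mulrA ler_pMr// mulr_ege1// exprn_ege1.
have := ler_wpM2l MN HH.
lra.
Qed.

(** Chebyshev's inequality applied to [cantor_second_moment]. *)
Lemma card_large_discrepancy {R : realType} q l m N (theta : nat -> R) (T : R) :
  (0 < q)%N -> (N <= 3 ^ q)%N -> (0 < N)%N -> (forall n, 0 <= theta n <= 1 / 3) ->
  0 <= T ->
  T ^+ 2 * (count (fun a => T < `|discrepancy m N theta (a%:R / (3 ^ (q + l))%:R)|)
     (cantor_numerators (q + l)))%:R <=
  (2 ^ l)%:R * (130 * (3 ^ q)%:R * N%:R * q%:R ^+ 2).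
Proof.
move=> q0 Nq N0 t01 T0; apply: le_trans (cantor_second_moment l m q0 Nq N0 t01).
rewrite -sum1_count natr_sum mulr_sumr big_mkcond/=; apply: ler_sum => a _.
case: ifP => [h|_]; last exact: sqr_ge0.
by rewrite mulr1 -[leRHS]real_normK ?num_real// ler_sqr ?nnegrE// ltW.
Qed.

(** Used with [x = i ^ 4], the square root of [N = i ^ 8]. Bernoulli's inequality bounds [q ^ 2] by
    [225 (16/15) ^ (2 q)]; the combined base [(16/15) ^ 2 * (3/2) = 128/75] has square below 3, so
    its [q]-th power is at most [2 x]. *)
Lemma cantor_growth_bound {R : realType} (q : nat) (x : R) :
  0 <= x -> 3 ^+ q <= 3 * x ^+ 2 -> q%:R ^+ 2 * (3 / 2) ^+ q <= 450 * x.
Proof.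
move=> x0 hq.
have bern : 1 + q%:R / 15 <= (16 / 15) ^+ q :> R.
  elim: q {hq} => [|q IH]; first by rewrite mul0r addr0 expr0.
  have : 0 <= q%:R :> R by [].
  by rewrite exprS -[q.+1%:R]natr1; nra.
have q2 : q%:R ^+ 2 <= 225 * ((16 / 15) ^+ 2) ^+ q :> R.
  have : 0 <= q%:R :> R by [].
  by rewrite -exprM mulnC exprM; nra.
have y2 : ((128 / 75) ^+ q) ^+ 2 <= (2 * x) ^+ 2 :> R.
  apply: (@le_trans _ _ (3 ^+ q)); last by rewrite exprMn; have := sqr_ge0 x; lra.
  by rewrite -exprM mulnC exprM lerXn2r ?nnegrE//; lra.
have y1 : (128 / 75) ^+ q <= 2 * x :> R.
  by rewrite -ler_sqr ?nnegrE ?exprn_ge0 ?mulr_ge0//; lra.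
apply: (@le_trans _ _ (225 * (128 / 75) ^+ q)); last by lra.
have -> : 128 / 75 = (16 / 15) ^+ 2 * (3 / 2) :> R by field.
rewrite [X in 225 * X]exprMn [leRHS]mulrA; apply: ler_wpM2r; last exact: q2.
by rewrite exprn_ge0//; lra.
Qed.

(** The first [up_log 3 N] digits supply at least [N] residues for the averaging. The other [2 N]
    digits make cylinders so short that [2 ^ n x], for [n < N], varies by at most [1 / N] on each,
    since [9 ^ N >= N * 2 ^ N]. *)
Definition ternary_depth (N : nat) : nat := (up_log 3 N + 2 * N)%N.

Lemma ternary_depth_resolution {R : realType} (N : nat) :
  N%:R * (2 ^+ N / (3 ^ ternary_depth N)%:R) <= 1 :> R.
Proof.
rewrite mulrA ler_pdivrMr ?ltr0n ?expn_gt0// mul1r -natrX -natrM ler_nat.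
rewrite /ternary_depth expnD expnM.
apply: (@leq_trans (9 ^ N)); last by rewrite leq_pmull// expn_gt0.
apply: (@leq_trans (4 ^ N)); last by case: N => // n; rewrite leq_exp2r.
by rewrite -[4%N]/(2 * 2)%N expnMn leq_mul2r ltnW ?orbT// ltn_expl.
Qed.

(** With [N = i ^ 8] and deviation [i ^ 7], Chebyshev gives the proportion
    [130 i ^ 8 q ^ 2 (3/2) ^ q / i ^ 14], and [cantor_growth_bound] replaces [q ^ 2 (3/2) ^ q] by
    [450 i ^ 4]. *)
Lemma card_cantor_bad {R : realType} m i (theta : nat -> R) :
  (1 < i)%N -> (forall n, (m <= n < i ^ 8)%N -> 0 <= theta n <= 1 / 3) ->
  (count (fun a => i%:R ^+ 7 <
       `|discrepancy m (i ^ 8) theta (a%:R / (3 ^ ternary_depth (i ^ 8))%:R)|)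
     (cantor_numerators (ternary_depth (i ^ 8))))%:R / (2 ^ ternary_depth (i ^ 8))%:R <= 130 * 450 / i%:R ^+ 2 :> R.
Proof.
move=> i1 t01; set N := (i ^ 8)%N; set L := ternary_depth N.
have N1 : (1 < N)%N by rewrite -(exp1n 8) ltn_exp2r.
pose q := up_log 3 N.
have q0 : (0 < q)%N by rewrite up_log_gt0.
have Nq : (N <= 3 ^ q)%N by apply: up_logP.
have qN : (3 ^ q <= 3 * N)%N.
  have /andP[h _] := up_log_bounds (isT : 1 < 3)%N N1.
  by rewrite -(prednK q0) expnS leq_mul2l/= ltnW.
pose th n := if (m <= n < N)%N then theta n else 0.
have th01 n : 0 <= th n <= 1 / 3.
  by rewrite /th; case: ifP => [/t01//|_]; rewrite lexx/=; lra.
have dE x : discrepancy m N theta x = discrepancy m N th x.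
  by rewrite /discrepancy [LHS]big_nat [RHS]big_nat; apply: eq_bigr => n h; rewrite /th h.
under eq_count do rewrite dE.
have i0 : 0 < i%:R :> R by rewrite ltr0n; lia.
have := @card_large_discrepancy R q (2 * N) m N th (i%:R ^+ 7) q0 Nq ltac:(lia) th01
  (exprn_ge0 _ (ltW i0)).
rewrite -/(ternary_depth N) -/L.
set c := (count _ _)%:R => h.
have gb : q%:R ^+ 2 * (3 / 2) ^+ q <= 450 * i%:R ^+ 4 :> R.
  apply: cantor_growth_bound; first by rewrite exprn_ge0// ltW.
  by rewrite -!exprM -!natrX -natrM ler_nat.
have p2 k : 0 < (2 ^ k)%:R :> R by rewrite ltr0n expn_gt0.
rewrite ler_pdivrMr// mulrAC ler_pdivlMr ?exprn_gt0//.
have i12 : 0 < i%:R ^+ 12 :> R by rewrite exprn_gt0.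
rewrite -(ler_pM2r i12).
have -> : c * i%:R ^+ 2 * i%:R ^+ 12 = (i%:R ^+ 7) ^+ 2 * c by ring.
apply: (le_trans h).
have -> : L = (2 * N + q)%N by rewrite /L /ternary_depth addnC.
rewrite expnD natrM -[leRHS]mulrA [leRHS]mulrC -!mulrA; apply: ler_wpM2l => //.
have -> : 130 * ((3 ^ q)%:R * (N%:R * q%:R ^+ 2)) =
  130 * i%:R ^+ 8 * (2 ^ q)%:R * (q%:R ^+ 2 * (3 / 2) ^+ q) :> R.
  rewrite /N !natrX expr_div_n; field.
  by rewrite expf_neq0.
have := ler_wpM2l (_ : 0 <= 130 * i%:R ^+ 8 * (2 ^ q)%:R) gb.
rewrite !mulr_ge0 ?exprn_ge0 ?(ltW i0)// => /(_ isT) /le_trans; apply.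
by rewrite le_eqVlt; apply/orP; left; apply/eqP; ring.
Qed.

Lemma near_int_le {R : realType} (x y t t' : R) :
  `|x - y| <= t' - t -> near_int x t -> near_int y t'.
Proof.
move=> xy /asboolP[p xp]; apply/asboolP; exists p.
by move: xy xp; rewrite !ler_norml => /andP[? ?] /andP[? ?]; apply/andP; split; lra.
Qed.

(** Moving from [x] to [y] is absorbed by enlarging the thresholds by [eta]; the subtracted main
    terms then change by at most [2 N eta <= 2]. *)
Lemma discrepancy_le {R : realType} m N (psi : nat -> R) (eta x y : R) :
  (forall n, (m <= n < N)%N -> `|2 ^+ n * x - 2 ^+ n * y| <= eta) -> 0 <= eta ->
  N%:R * eta <= 1 ->
  discrepancy m N psi x <= discrepancy m N (fun n => psi n + eta) y + 2.
Proof.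
move=> h eta0 Ne.
apply: (@le_trans _ _ (discrepancy m N (fun n => psi n + eta) y + \sum_(m <= n < N) 2 * eta)).
  rewrite /discrepancy -big_split/= big_nat [leRHS]big_nat; apply: ler_sum => n mn.
  have : (near_int (2 ^+ n * x) (psi n))%:R <=
         (near_int (2 ^+ n * y) (psi n + eta))%:R :> R.
    rewrite ler_nat; case nx: (near_int _ _) => //.
    by rewrite (near_int_le _ nx)// addrAC subrr add0r h.
  lra.
rewrite lerD2l sumr_const_nat -[_ *+ (_ - _)]mulr_natl.
apply: (@le_trans _ _ (N%:R * (2 * eta))); last by lra.
by rewrite ler_wpM2r ?mulr_ge0// ler_nat leq_subr.
Qed.

Lemma discrepancy_ge {R : realType} m N (psi : nat -> R) (eta x y : R) :
  (forall n, (m <= n < N)%N -> `|2 ^+ n * x - 2 ^+ n * y| <= eta) -> 0 <= eta ->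
  N%:R * eta <= 1 ->
  discrepancy m N (fun n => psi n - eta) y - 2 <= discrepancy m N psi x.
Proof.
move=> h eta0 Ne; rewrite lerBlDr.
have -> : discrepancy m N psi x = discrepancy m N (fun n => psi n - eta + eta) x.
  by rewrite /discrepancy; apply: eq_bigr => n _; rewrite subrK.
by apply: discrepancy_le => // n mn; rewrite distrC h.
Qed.

(* The bad numerators at the enlarged and shrunk thresholds psi +- eta account for
   every point x of the Cantor set with large discrepancy at threshold psi. *)
Lemma discrepancy_cover {R : realType} m i (psi : nat -> R) :
  let N := (i ^ 8)%N in
  let L := ternary_depth N in
  (1 < i)%N -> (forall n, (m <= n < N)%N -> N%:R^-1 <= psi n <= 1 / 4) ->
  12 <= i%:R :> R ->
  exists2 s : seq nat, (size s)%:R / (2 ^ L)%:R <= 260 * 450 / i%:R ^+ 2 :> R &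
    forall x : R, cantor_set x -> i%:R ^+ 7 + 2 < `|discrepancy m N psi x| ->
      exists2 a, a \in s & a%:R / (3 ^ L)%:R <= x <= (a%:R + 1) / (3 ^ L)%:R.
Proof.
move=> N L i1 hpsi i12.
pose eta : R := 2 ^+ N / (3 ^ L)%:R.
have L0 : 0 < (3 ^ L)%:R :> R by rewrite ltr0n expn_gt0.
have eta0 : 0 <= eta by rewrite divr_ge0// ltW.
have Ne : N%:R * eta <= 1 by exact: ternary_depth_resolution.
have N12 : 12 <= N%:R :> R.
  by apply: (le_trans i12); rewrite ler_nat -{1}(expn1 i) leq_exp2l.
have N0 : 0 < N%:R :> R by lra.
have eN : eta <= N%:R^-1 by rewrite -[leRHS]mul1r ler_pdivlMr// mulrC.
(* Since [1/4 + 1/12 = 1/3], the enlarged thresholds stay admissible; the shrunk ones stay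
   nonnegative because [eta <= 1 / N <= psi n]. *)
have N12' : N%:R^-1 <= 1 / 12 :> R by rewrite div1r lef_pV2 ?posrE.
pose bad (e : R) (a : nat) :=
  i%:R ^+ 7 < `|discrepancy m N (fun n => psi n + e) (a%:R / (3 ^ L)%:R)|.
have bad_le e : `|e| <= eta -> (size (seq.filter (bad e) (cantor_numerators L)))%:R / (2 ^ L)%:R
    <= 130 * 450 / i%:R ^+ 2 :> R.
  rewrite ler_norml size_filter => /andP[e1 e2]; apply: card_cantor_bad => // n mn.
  by have /andP[p1 p2] := hpsi _ mn; apply/andP; split; lra.
exists (seq.filter (bad eta) (cantor_numerators L) ++ seq.filter (bad (- eta)) (cantor_numerators L)).
  rewrite size_cat natrD mulrDl.
  have := bad_le eta; rewrite ger0_norm// => /(_ (lexx _)).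
  have := bad_le (- eta); rewrite normrN ger0_norm// => /(_ (lexx _)).
  lra.
move=> x Cx xbad.
have [a aL ax] := cantor_step_cover (Cx L I).
exists a => //; rewrite mem_cat !mem_filter aL !andbT /bad.
move/andP: ax => [a1 a2]; rewrite mulrDl mul1r in a2.
have dist n : (m <= n < N)%N -> `|2 ^+ n * x - 2 ^+ n * (a%:R / (3 ^ L)%:R)| <= eta.
  move=> /andP[_ nN]; rewrite -mulrBr normrM ger0_norm ?exprn_ge0// ler_pM//.
    by rewrite ler_weXn2l ?ler1n// ltnW.
  by rewrite ger0_norm ?subr_ge0// lerBlDl.
have d1 := discrepancy_le psi dist eta0 Ne.
have d2 := discrepancy_ge psi dist eta0 Ne.
move: xbad; apply: contraTT; rewrite negb_or -!leNgt => /andP[].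
rewrite !ler_norml => /andP[? ?] /andP[? ?].
by apply/andP; split; lra.
Qed.

(** * Coverings by cylinders *)

Section cantor_covering.
Context {R : realType}.
Local Open Scope ereal_scope.

Lemma nneseries_le_bound (u : (\bar R)^nat) (c : \bar R) :
  (forall i, 0 <= u i) -> (forall n, \sum_(0 <= i < n) u i <= c) ->
  \sum_(i <oo) u i <= c.
Proof.
move=> u0 h; apply: lime_le; first exact: is_cvg_nneseries.
exact: nearW.
Qed.

Definition cantor_dim : R := (ln 2 / ln 3)%R.

Lemma powR_cantor_dim (L : nat) :
  (((3 ^ L)%:R^-1 : R) `^ cantor_dim = (2 ^ L)%:R^-1)%R.
Proof.
have p3 : (0 < (3 ^ L)%:R^-1 :> R)%R by rewrite invr_gt0 ltr0n expn_gt0.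
rewrite /powR gt_eqF// lnV ?posrE ?ltr0n ?expn_gt0// !natrX lnXn ?ltr0n//.
rewrite -[(ln 3 *+ L)%R]mulr_natr mulrN mulrA /cantor_dim divfK ?gt_eqF ?ln_gt0 ?ltr1n//.
by rewrite expRN expRM_natr lnK// posrE.
Qed.

Lemma diam_itv_le (a b : R) : (a <= b)%R ->
  diam [set x | (a <= x <= b)%R] <= (b - a)%:E.
Proof.
move=> ab; apply: ge_ereal_sup => _ [x /= /andP[ax xb]] [y /= /andP[ay yb]] <-.
by rewrite lee_fin ler_norml; apply/andP; split; lra.
Qed.

Lemma hausdorff_weight_cylinder (L a : nat) :
  hausdorff_weight cantor_dim
    [set x : R | (a%:R / (3 ^ L)%:R <= x <= (a%:R + 1) / (3 ^ L)%:R)%R] <=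
  ((2 ^ L)%:R^-1)%:E.
Proof.
rewrite /hausdorff_weight; case: ifPn => [_|/set0P[x hx]].
  by rewrite lee_fin invr_ge0.
have hd : diam [set x : R | (a%:R / (3 ^ L)%:R <= x <= (a%:R + 1) / (3 ^ L)%:R)%R] <=
    ((3 ^ L)%:R^-1)%:E.
  rewrite [X in _ <= X%:E](_ : _ = (a%:R + 1) / (3 ^ L)%:R - a%:R / (3 ^ L)%:R)%R.
    by apply: diam_itv_le; rewrite ler_wpM2r ?invr_ge0// lerDl.
  by rewrite -mulrBl addrAC subrr add0r mul1r.
(* The point [x] rules out the diameter [-oo]. *)
have d0 : 0 <= diam [set x : R | (a%:R / (3 ^ L)%:R <= x <= (a%:R + 1) / (3 ^ L)%:R)%R].
  by apply: ereal_sup_ubound; exists x => //; exists x => //; rewrite subrr normr0.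
move: hd d0; case: (diam _) => [r| |]//.
rewrite !lee_fin => hr r0; rewrite -powR_cantor_dim.
apply: ge0_ler_powR => //; rewrite ?nnegrE ?invr_ge0//.
by rewrite /cantor_dim divr_ge0// ltW// ln_gt0// ltr1n.
Qed.

Lemma hausdorff_content_cylinders (delta : R) (L : nat) (s : seq nat) (A : set R) :
  ((3 ^ L)%:R^-1 <= delta)%R ->
  (forall x, A x -> exists2 a, a \in s &
     (a%:R / (3 ^ L)%:R <= x <= (a%:R + 1) / (3 ^ L)%:R)%R) ->
  hausdorff_content cantor_dim delta A <= ((size s)%:R / (2 ^ L)%:R)%:E.
Proof.
move=> Ld hA.
have d0 : (0 <= delta)%R by apply: le_trans Ld; rewrite invr_ge0.
pose cyl (a : nat) := [set x : R | (a%:R / (3 ^ L)%:R <= x <= (a%:R + 1) / (3 ^ L)%:R)%R].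
pose U i := if (i < size s)%N then cyl (nth 0%N s i) else set0.
apply: (@le_trans _ _ (\sum_(i <oo) hausdorff_weight cantor_dim (U i))).
  apply: ereal_inf_lbound; exists U => //; split.
    move=> i; rewrite /U; case: ifP => _; last by rewrite diam0 leNye.
    apply: le_trans (diam_itv_le _) _; first by rewrite ler_wpM2r ?invr_ge0// lerDl.
    by rewrite lee_fin -mulrBl addrAC subrr add0r mul1r.
  move=> x /hA[a a_s ax]; exists (index a s) => //.
  by rewrite /U index_mem a_s nth_index.
apply: nneseries_le_bound => [i|n]; first exact: hausdorff_weight_ge0.
apply: (@le_trans _ _ (\sum_(0 <= i < n) (if (i < size s)%N then ((2 ^ L)%:R^-1)%R else 0%R)%:E)).
  apply: lee_sum => i _; rewrite /U; case: ifP => _; first exact: hausdorff_weight_cylinder.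
  by rewrite hausdorff_weight0.
rewrite sumEFin lee_fin.
apply: (@le_trans _ _ (\sum_(0 <= i < n + size s) (if (i < size s)%N then ((2 ^ L)%:R^-1)%R else 0%R))%R).
  rewrite [leRHS](@big_cat_nat _ _ _ n)//= ?leq_addr// lerDl sumr_ge0// => i _.
  by case: ifP => // _; rewrite invr_ge0.
rewrite (@big_cat_nat _ _ _ (size s))//= ?leq_addl//.
rewrite [X in (_ + X)%R](_ : _ = 0)%R; last first.
  by rewrite big_nat big1// => i /andP[si _]; rewrite ltnNge si.
rewrite addr0.
rewrite big_nat (eq_bigr (fun=> (2 ^ L)%:R^-1)%R); last by move=> i /andP[_ ->].
by rewrite -big_nat sumr_const_nat subn0 mulr_natl.
Qed.

(** Telescoping, by [1 / j ^ 2 <= 2 / (j (j + 1)) = 2 / j - 2 / (j + 1)] for [j >= 1]. *)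
Lemma sum_inv_sqr_le (k n : nat) : (0 < k)%N ->
  (\sum_(0 <= i < n) (k + i)%:R ^- 2 <= 2 / k%:R :> R)%R.
Proof.
move=> k0.
suff : (\sum_(0 <= i < n) (k + i)%:R ^- 2 <= 2 / k%:R - 2 / (k + n)%:R :> R)%R.
  by move/le_trans; apply; rewrite lerBlDr lerDl divr_ge0.
elim: n => [|n IH]; first by rewrite big_geq// addn0 subrr.
rewrite big_nat_recr//= addnS -[(k + n).+1%:R]natr1.
have j1 : (1 <= (k + n)%:R :> R)%R by rewrite ler1n; lia.
move: IH j1; move: ((k + n)%:R)%R => j IH j1.
have key : (j ^- 2 <= 2 / j - 2 / (j + 1))%R.
  have -> : (2 / j - 2 / (j + 1) = 2 / (j * (j + 1)))%R by field; lra.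
  rewrite -[(j ^- 2)%R]div1r ler_pdivrMr ?exprn_gt0//; last by lra.
  rewrite mulrAC ler_pdivlMr ?mulr_gt0//; [nra|lra|lra].
lra.
Qed.

(* Borel-Cantelli for the outer measure. *)
Lemma hausdorff_measure_limsup0 (A : set R) (E : (set R)^nat) (c : R) :
  (0 <= c)%R ->
  (forall k, A `<=` \bigcup_i E (k + i)%N) ->
  (forall delta : R, (0 < delta)%R -> exists k, forall i, (k <= i)%N ->
     hausdorff_content cantor_dim delta (E i) <= (c / i%:R ^+ 2)%:E) ->
  hausdorff_measure cantor_dim A = 0.
Proof.
move=> c0 AE hE; apply/eqP; rewrite eq_le hausdorff_measure_ge0 andbT.
apply: ge_ereal_sup => _ [delta /= d0 <-].
have [k0 hk0] := hE _ d0.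
have bound k : (k0 <= k)%N -> (0 < k)%N ->
    hausdorff_content cantor_dim delta A <= (2 * c / k%:R)%:E.
  move=> k0k kpos.
  apply: le_trans (le_hausdorff_content _ _ (AE k)) _.
  apply: le_trans (hausdorff_content_sigma_subadditive _ _ _) _.
  apply: nneseries_le_bound => [i|n]; first exact: hausdorff_content_ge0.
  apply: (@le_trans _ _ (\sum_(0 <= i < n) (c * (k + i)%:R ^- 2)%:E)).
    apply: lee_sum => i _; apply: hk0; exact: leq_trans (leq_addr _ _).
  rewrite sumEFin lee_fin -mulr_sumr [(2 * c)%R]mulrC -mulrA.
  by apply: ler_wpM2l => //; exact: sum_inv_sqr_le.
apply/lee_addgt0Pr => e e0; rewrite add0e.
pose k := (maxn k0 (Num.truncn (2 * c / e)).+1).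
have kpos : (0 < k)%N by rewrite /k; lia.
apply: (le_trans (bound k (leq_maxl _ _) kpos)).
rewrite lee_fin ler_pdivrMr ?ltr0n// [leRHS]mulrC -ler_pdivrMr//.
apply: (@le_trans _ _ (Num.truncn (2 * c / e)).+1%:R); first exact/ltW/(real_truncnS_gt (num_real _)).
by rewrite ler_nat leq_maxr.
Qed.

(** A set of outer measure 0 is Caratheodory measurable, so the exceptional set is its own
    measurable null cover. *)
Lemma cantor_measure_ae (P : R -> Prop) :
  hausdorff_measure cantor_dim ((~` [set x | cantor_set x -> P x]) `&` @cantor_set R) = 0 ->
  {ae cantor_measure R, forall x : R, cantor_set x -> P x}.
Proof.
move=> h; exists (~` [set x | cantor_set x -> P x]); split => //.
apply: le_caratheodory_measurable => X.
rewrite [X in X + _ <= _](_ : _ = 0); last first.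
  apply/eqP; rewrite eq_le outer_measure_ge0 andbT -[leRHS]h.
  by apply: le_hausdorff_measure => x [[_ hx] Cx]; split.
by rewrite add0e; apply: le_outer_measure => x [].
Qed.
End cantor_covering.

(** * From the sparse sequence to the asymptotics *)

Section threshold.
Context {R : realType}.

Definition psi (n : nat) : R := n%:R `^ (- (1 / 100)).

Lemma psiE n : psi n = (n%:R `^ (1 / 100))^-1.
Proof. by rewrite /psi powRN. Qed.

Lemma psi_ge0 n : 0 <= psi n. Proof. exact: powR_ge0. Qed.

Lemma powR100_ge1 n : (0 < n)%N -> 1 <= n%:R `^ (1 / 100) :> R.
Proof.
move=> n0; have {1}-> : 1 = (1 : R) `^ (1 / 100) by rewrite powR1.
by apply: ge0_ler_powR; rewrite ?nnegrE ?ler1n//; lra.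
Qed.

Lemma psi_le1 n : (0 < n)%N -> psi n <= 1.
Proof. by move=> n0; rewrite psiE invf_le1 ?powR100_ge1// (lt_le_trans ltr01)// powR100_ge1. Qed.

Lemma psi_anti m n : (0 < m)%N -> (m <= n)%N -> psi n <= psi m.
Proof.
move=> m0 mn; rewrite !psiE lef_pV2 ?posrE ?powR_gt0 ?ltr0n//; last exact: leq_trans mn.
by apply: ge0_ler_powR; rewrite ?nnegrE ?ler_nat//; lra.
Qed.

Lemma psi_ge_inv n : (0 < n)%N -> n%:R^-1 <= psi n.
Proof.
move=> n0; rewrite psiE lef_pV2 ?posrE ?powR_gt0 ?ltr0n//.
by apply: ler1_powR; rewrite ?ler1n//; lra.
Qed.

Lemma psi_small : exists2 m : nat, (0 < m)%N & forall n, (m <= n)%N -> psi n <= 1 / 4.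
Proof.
exists (Num.truncn ((4 : R) `^ 100)).+1 => // n mn.
have h4 : (4 : R) `^ 100 <= n%:R.
  apply: ltW; apply: lt_le_trans (real_truncnS_gt (num_real _)) _.
  by rewrite ler_nat.
have n0 : (0 < n)%N by apply: leq_ltn_trans mn.
rewrite psiE [1 / 4]div1r lef_pV2 ?posrE ?powR_gt0 ?ltr0n//.
have -> : 4 = ((4 : R) `^ 100) `^ (1 / 100).
  by rewrite -powRrM mulrCA divff ?mulr1 ?powRr1//; lra.
by apply: ge0_ler_powR; rewrite ?nnegrE ?powR_ge0//; lra.
Qed.

(** Natural and integral [p] agree here: [x >= 0] and [psi n < 1] exclude [p <= -1]. *)
Lemma near_int_dyadic (x : R) n : 0 <= x -> (0 < n)%N -> psi n < 1 ->
  `[< exists p : nat, `|x - p%:R / 2 ^+ n| <= 1 / (n%:R `^ (1 / 100) * 2 ^+ n) >] =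
  near_int (2 ^+ n * x) (psi n).
Proof.
move=> x0 n0 p1; have p2 : 0 < 2 ^+ n :> R by rewrite exprn_gt0.
have y0 : 0 < n%:R `^ (1 / 100) :> R by rewrite powR_gt0// ltr0n.
have key (p : R) : (`|x - p / 2 ^+ n| <= 1 / (n%:R `^ (1 / 100) * 2 ^+ n)) =
    (`|2 ^+ n * x - p| <= psi n).
  have -> : x - p / 2 ^+ n = (2 ^+ n * x - p) / 2 ^+ n by field; rewrite gt_eqF.
  rewrite [leRHS]div1r invfM -psiE normrM [`|(2 ^+ n)^-1|]gtr0_norm ?invr_gt0//.
  by rewrite ler_pM2r ?invr_gt0.
apply/asboolP/asboolP => [[p]|[p hp]]; first by rewrite key => hp; exists p%:Z.
have p0 : 0 <= p.
  rewrite leNgt; apply/negP => pneg.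
  have pR : p%:~R <= -1 :> R by rewrite -[-1]/((-1)%:~R) ler_int; lia.
  move: hp; rewrite ler_norml => /andP[_].
  have : 0 <= 2 ^+ n * x by rewrite mulr_ge0// ltW.
  lra.
by move: hp; case: p p0 => // p _ hp; exists p; rewrite key.
Qed.

(** For [N + 1] between [i ^ 8] and [(i + 1) ^ 8] the error is [O(i ^ 7)], since the gap has
    [O(i ^ 7)] terms of size at most 2. The main term has order at least [N ^ (99/100)], which
    dominates [N ^ (7/8)]. *)
Lemma asymp_equiv_of_sparse_bound (c : nat -> bool) (m : nat) : (0 < m)%N ->
  (exists k, forall i, (k <= i)%N ->
    `|\sum_(m <= n < i ^ 8) ((c n)%:R - 2 * psi n)| <= i%:R ^+ 7 + 2) ->
  asymp_equiv (fun N => \sum_(1 <= n < N.+1) (c n)%:R)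
              (fun N => 2 * \sum_(1 <= n < N.+1) psi n).
Proof.
move=> m0 [k hk].
pose d n : R := (c n)%:R - 2 * psi n.
have dle n : (0 < n)%N -> `|d n| <= 2.
  move=> n0; have := psi_le1 n0; have := psi_ge0 n; rewrite /d ler_norml.
  by case: (c n) => /= h1 h2; apply/andP; split; lra.
have dsum a b : (0 < a)%N -> `|\sum_(a <= n < b) d n| <= 2 * (b - a)%:R.
  move=> a0; apply: le_trans (ler_norm_sum _ _ _) _.
  apply: (@le_trans _ _ (\sum_(a <= n < b) 2)).
    rewrite big_nat [leRHS]big_nat; apply: ler_sum => n /andP[an _].
    by rewrite dle// (leq_trans a0).
  by rewrite sumr_const_nat mulr_natr.
(* In units of [i ^ 7]: [2 m] for the indices below [m], 3 for [i ^ 7 + 2], and [510 = 2 * 255] for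
   the gap. *)
pose C : R := 2 * m%:R + 513.
have C0 : 0 < C by rewrite /C; have : 0 <= m%:R :> R by []; lra.
apply/cvgrPdist_le => e e0.
(* The last entry ensures [2 C ^ 2 <= e ^ 2 i], which with [y ^ 2 <= 2 i] yields [C y <= e i]. *)
pose K := maxn (maxn k m) (Num.truncn (2 * C ^+ 2 / e ^+ 2)).+1.
exists (K ^ 8)%N => // N /= KN.
have K0 : (0 < K)%N by rewrite /K; lia.
have N0 : (0 < N)%N by rewrite (leq_trans _ KN)// expn_gt0 K0.
have [i iN Ni] : exists2 i, (i ^ 8 <= N.+1)%N & (N.+1 < i.+1 ^ 8)%N.
  have exP : exists i, (i ^ 8 <= N.+1)%N by exists 0%N.
  have ubP i : (i ^ 8 <= N.+1 -> i <= N.+1)%N.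
    by move=> h; apply: leq_trans h; case: i => // i; rewrite -{1}(expn1 i.+1) leq_pexp2l.
  case: (ex_maxnP exP ubP) => i iN imax; exists i => //.
  by rewrite ltnNge; apply/negP => /imax; rewrite ltnn.
have Ki : (K <= i)%N.
  rewrite -ltnS -(ltn_exp2r _ _ (isT : 0 < 8)%N); apply: leq_ltn_trans Ni.
  exact: leqW.
have i1 : 1 <= i%:R :> R by rewrite ler1n (leq_trans K0).
have mi : (m <= i)%N by rewrite (leq_trans _ Ki)// /K; lia.
have ki : (k <= i)%N by rewrite (leq_trans _ Ki)// /K; lia.
have mi8 : (m <= i ^ 8)%N by rewrite (leq_trans mi)// -{1}(expn1 i) leq_pexp2l// (leq_trans m0).
have i7 : 1 <= i%:R ^+ 7 :> R by rewrite exprn_ege1.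
(* Here [255 = 2 ^ 8 - 1] is the sum of the binomial coefficients other than the leading one. *)
have gap : (N.+1 - i ^ 8)%:R <= 255 * i%:R ^+ 7 :> R.
  have : N.+1%:R <= (i%:R + 1) ^+ 8 :> R by rewrite natr1 -natrX ler_nat ltnW.
  rewrite natrB// natrX.
  have pw j : (j <= 7)%N -> i%:R ^+ j <= i%:R ^+ 7 :> R by move=> j7; rewrite ler_weXn2l.
  have -> : (i%:R + 1) ^+ 8 = i%:R ^+ 8 + 8 * i%:R ^+ 7 + 28 * i%:R ^+ 6 +
    56 * i%:R ^+ 5 + 70 * i%:R ^+ 4 + 56 * i%:R ^+ 3 + 28 * i%:R ^+ 2 + 8 * i%:R ^+ 1 + 1 :> R.
    by ring.
  have := pw 6 isT; have := pw 5 isT; have := pw 4 isT; have := pw 3 isT.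
  have := pw 2 isT; have := pw 1 isT; lra.
have Sle : `|\sum_(1 <= n < N.+1) d n| <= C * i%:R ^+ 7.
  rewrite (@big_cat_nat _ _ _ m)//= ?(leq_trans mi8)//.
  rewrite [X in _ + X](@big_cat_nat _ _ _ (i ^ 8))//=.
  have h1 := dsum 1%N m isT.
  have h2 := hk i ki; rewrite -/(d _) in h2.
  have h3 := dsum (i ^ 8)%N N.+1 (leq_trans m0 mi8).
  have m1 : (m - 1)%:R <= m%:R :> R by rewrite ler_nat leq_subr.
  have m2 : m%:R <= m%:R * i%:R ^+ 7 :> R by rewrite ler_peMr.
  apply: le_trans (ler_normD _ _) _; apply: le_trans (lerD h1 (ler_normD _ _)) _.
  move: h2 h3; rewrite /C mulrDl; lra.
pose y : R := N%:R `^ (1 / 100).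
have y1 : 1 <= y by exact: powR100_ge1.
have y0 : 0 < y by lra.
have y100 : y ^+ 100 = N%:R.
  rewrite -powR_mulrn ?(ltW y0)// /y -powRrM (_ : 1 / 100 * 100%:R = 1) ?powRr1//.
  by field.
(* Crude but sufficient: [y ^ 16 <= y ^ 100 = N], and [N] is below [(i + 1) ^ 8 <= (2 i) ^ 8]. *)
have y2 : y ^+ 2 <= 2 * i%:R.
  rewrite -(@ler_pXn2r _ 8)// ?nnegrE ?exprn_ge0 ?mulr_ge0 ?(ltW y0)//.
  rewrite -exprM; apply: (@le_trans _ _ (y ^+ 100)); first by rewrite ler_weXn2l.
  rewrite y100 -natrM -!natrX ler_nat.
  apply: (@leq_trans (i.+1 ^ 8)); first by rewrite ltnW// (leq_trans _ Ni).
  by rewrite leq_exp2r// mul2n -addnn -addn1 leq_add2l (leq_trans m0).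
have i0 : 0 < i%:R :> R by lra.
have big_i : 2 * C ^+ 2 <= e ^+ 2 * i%:R.
  rewrite [leRHS]mulrC -ler_pdivrMr ?exprn_gt0//.
  apply: ltW; apply: lt_le_trans (real_truncnS_gt (num_real _)) _.
  by rewrite ler_nat (leq_trans _ Ki)// leq_maxr.
have Cy : C * y <= e * i%:R.
  rewrite -(@ler_pXn2r _ 2)// ?nnegrE ?mulr_ge0 ?(ltW y0) ?(ltW C0) ?(ltW e0)//.
  rewrite !exprMn; apply: (@le_trans _ _ (C ^+ 2 * (2 * i%:R))).
    by rewrite ler_wpM2l ?sqr_ge0.
  rewrite [i%:R ^+ 2]expr2 [leRHS]mulrA.
  rewrite (_ : C ^+ 2 * (2 * i%:R) = 2 * C ^+ 2 * i%:R); last by ring.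
  by rewrite ler_wpM2r// ltW.
set F := \sum_(1 <= n < N.+1) (c n)%:R; set G := 2 * \sum_(1 <= n < N.+1) psi n.
have FG : F - G = \sum_(1 <= n < N.+1) d n by rewrite /F /G mulr_sumr -sumrB.
(* Each [psi n] with [n <= N] is at least [psi N = 1 / y], and [i ^ 8 <= N + 1 <= 2 N]. *)
have Gy : i%:R ^+ 8 <= G * y.
  apply: (@le_trans _ _ (2 * N%:R)).
    by rewrite -natrX -natrM ler_nat (leq_trans iN)// mul2n -addnn -addn1 leq_add2l.
  rewrite /G -mulrA ler_wpM2l// -ler_pdivrMr//.
  apply: (@le_trans _ _ (\sum_(1 <= n < N.+1) psi N)).
    by rewrite sumr_const_nat subSS subn0 -[leRHS]mulr_natl psiE.
  rewrite big_nat [leRHS]big_nat; apply: ler_sum => n /andP[n0 nN].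
  exact: psi_anti.
have G0 : 0 < G.
  by rewrite -(pmulr_lgt0 _ y0) (lt_le_trans _ Gy)// exprn_gt0.
have -> : 1 - F / G = - (F - G) / G by field; rewrite gt_eqF.
rewrite normrM normrN FG [`|G^-1|]gtr0_norm ?invr_gt0// ler_pdivrMr//.
apply: (le_trans Sle); rewrite -(ler_pM2r y0).
apply: (@le_trans _ _ (e * i%:R ^+ 8)); last by rewrite -mulrA ler_wpM2l// ltW.
rewrite mulrAC [i%:R ^+ 8]exprSr mulrA [e * _]mulrC -[leRHS]mulrA mulrC.
by rewrite ler_wpM2l// ?exprn_ge0 ?(ltW i0).
Qed.

End threshold.

(** * Almost sure asymptotics on the Cantor set *)

Theorem corollary1p6 (R : realType) :
  {ae cantor_measure R, forall x : R, cantor_set x ->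
    @asymp_equiv R
      (fun N : nat =>
         #|[pred n : 'I_N.+1 | (1 <= n)%N &&
              `[< exists p : nat, `|x - p%:R / 2 ^+ n|
                    <= 1 / (n%:R `^ (1 / 100) * 2 ^+ n) >]]|%:R)
      (fun N : nat => 2 * \sum_(1 <= n < N.+1) n%:R `^ (- (1 / 100)))}.
Proof.
have [m m0 psim] := @psi_small R.
apply: cantor_measure_ae.
pose E i := [set x : R | cantor_set x /\
  i%:R ^+ 7 + 2 < `|discrepancy m (i ^ 8) psi x|].
apply: (@hausdorff_measure_limsup0 R _ E (260 * 450)).
  exact: mulr_ge0 (ler0n _ _) (ler0n _ _).
  (* By contraposition: a point of the Cantor set outside every [E i] with [i >= k] satisfies the
     sparse bound, hence the asymptotics. *)
  move=> k x [nP Cx]; apply: contrapT => notE; apply: nP => _.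
  have x0 : 0 <= x by have := Cx 0%N I; rewrite /= in_itv/= => /andP[].
  pose c n := `[< exists p : nat, `|x - p%:R / 2 ^+ n|
                    <= 1 / (n%:R `^ (1 / 100) * 2 ^+ n) >].
  rewrite (_ : (fun N => _) = fun N => \sum_(1 <= n < N.+1) (c n)%:R); last first.
    apply/funext => N; rewrite -sum1_card natr_sum (big_nat_widenl _ 0%N)//.
    rewrite big_mkord [RHS]big_mkcond [LHS]big_mkcond; apply: eq_bigr => n _ /=.
    by rewrite inE; case: (0 < n)%N => //=; rewrite -/(c n); case: (c n).
  apply: (asymp_equiv_of_sparse_bound m0); exists k => i ki.
  rewrite leNgt; apply/negP => ibad; apply: notE; exists (i - k)%N => //=.
  rewrite subnKC//; split=> //; apply: (lt_le_trans ibad).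
  rewrite le_eqVlt; apply/orP; left; apply/eqP; congr `|_|; rewrite /discrepancy.
  rewrite big_nat [RHS]big_nat; apply: eq_bigr => n /andP[mn _].
  rewrite /c near_int_dyadic// ?(leq_trans m0)//.
  by have := psim n mn; lra.
move=> delta d0.
(* The 12 is required by [discrepancy_cover]; the other summand gives [1 / delta <= i <= 3 ^ L], so
   the cylinders have diameter at most [delta]. *)
exists (Num.truncn delta^-1 + 12)%N => i hi.
have i12 : (12 <= i)%N by rewrite (leq_trans _ hi)// leq_addl.
have iN : (i <= i ^ 8)%N by rewrite -{1}(expn1 i) leq_pexp2l// (leq_trans _ i12).
have [|||s hs cover] := @discrepancy_cover R m i psi.
- exact: leq_trans i12.
- move=> n /andP[mn nN]; rewrite psim// andbT.
  have n0 := leq_trans m0 mn.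
  apply: le_trans (psi_ge_inv n0); rewrite lef_pV2 ?posrE ?ltr0n ?ler_nat//.
  + exact: ltnW.
  + by rewrite (leq_trans _ iN)// (leq_trans _ i12).
- by rewrite ler_nat.
apply: (@le_trans _ _ ((size s)%:R / (2 ^ ternary_depth (i ^ 8))%:R)%:E); last first.
  by rewrite lee_fin.
apply: hausdorff_content_cylinders => [|x [Cx bx]]; last exact: cover.
rewrite invf_ple ?posrE ?ltr0n ?expn_gt0//.
apply: ltW; apply: lt_le_trans (real_truncnS_gt (num_real _)) _.
rewrite ler_nat; apply: (@leq_trans i).
  by rewrite (leq_trans _ hi)// -addn1 leq_add2l.
apply: (leq_trans iN); apply: (@leq_trans (ternary_depth (i ^ 8))).
  by rewrite /ternary_depth (leq_trans _ (leq_addl _ _))// leq_pmull.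
exact/ltnW/ltn_expl.
Qed.
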